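(* In three spacetime dimensions, let $\#(n)$ denote the number of linearly independent scalar densities of curvature order $n$ that can be built from contractions of $n$ Riemann (equivalently Ricci) tensors with the metric. Then for all integers $n\ge1$ $$\#(n)=\frac{1}{72}\Big[47+9(-1)^n+6n(6+n)+16\cos\Big(\frac{2\pi n}{3}\Big)\Big]=\Big\lceil\frac n2\Big(\frac n6+1\Big)+\epsilon\Big\rceil$$ for any sufficiently small $\epsilon>0$. Moreover, for $n\ge6$ (with $\#(0)=1$), $$\#(n-6)=\#(n)-n .$$
   Context: In three dimensions the Weyl tensor vanishes, so all contractions reduce to contractions of the Ricci tensor. By the Schouten identities $\delta^{a_1\dots a_m}_{b_1\dots b_m}R^{b_1}_{a_1}\cdots R^{b_m}_{a_m}=0$ for $m>3$, every such density is a polynomial in $R$, $\mathcal{R}_2=R_a^bR_b^a$ and $\mathcal{R}_3=R_a^bR_b^cR_c^a$; an independent basis at order $n$ is given by the monomials $R^i\mathcal{R}_2^j\mathcal{R}_3^k$ with non-negative integers satisfying $i+2j+3k=n$. *)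

(* Defs.v *)
From mathcomp Require Import all_boot all_order all_algebra all_fingroup.
From mathcomp Require Import boolp reals trigo.

Set Implicit Arguments.
Unset Strict Implicit.
Unset Printing Implicit Defensive.

Import Order.TTheory GRing.Theory Num.Theory.
Local Open Scope ring_scope.

Definition minkowski (R : realType) : 'M[R]_3 :=
  diag_mx (\row_(i < 3) if i == 0 then -1 else 1).

Definition lorentzian (R : realType) (g : 'M[R]_3) : Prop :=
  exists2 P : 'M[R]_3, P \in unitmx & g = P^T *m minkowski R *m P.

Definition riemann_symmetries (R : realType)
    (T : 'I_3 -> 'I_3 -> 'I_3 -> 'I_3 -> R) : Prop :=
  [/\ forall a b c d, T b a c d = - T a b c d,
      forall a b c d, T a b d c = - T a b c d,
      forall a b c d, T c d a b = T a b c d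
    & forall a b c d, T a b c d + T a c d b + T a d b c = 0].

(* The values at a point of a Lorentzian metric and of its all-covariant
   Riemann tensor.  In Riemann normal coordinates every such pair is realised
   by an actual metric near the point, so a linear relation between curvature
   scalars holds identically iff it holds on all these pairs. *)
Record curvature_data (R : realType) := CurvatureData {
  metric : 'M[R]_3;
  riemann : 'I_3 -> 'I_3 -> 'I_3 -> 'I_3 -> R;
  metric_lorentzian : lorentzian metric;
  riemann_symP : riemann_symmetries riemann }.

(* R_{bd} = g^{ac} R_{abcd} *)
Definition ricci (R : realType) (x : curvature_data R) (b d : 'I_3) : R :=
  \sum_(a < 3) \sum_(c < 3) invmx (metric x) a c * riemann x a b c d.

(* Covariant tensors of rank r, as functions of their r indices. *)
Definition riemann_tensor (R : realType) (x : curvature_data R)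
    (a : 'I_4 -> 'I_3) : R := riemann x (a 0) (a 1) (a 2) (a 3).

Definition ricci_tensor (R : realType) (x : curvature_data R)
    (a : 'I_2 -> 'I_3) : R := ricci x (a 0) (a 1).

(* The pair (i, j) stands for the j-th index of the i-th of n copies of a
   tensor of rank r.  A complete contraction is a way of pairing off all these
   indices, encoded as an involution without fixed points. *)
Definition pairings (n r : nat) : {set {perm 'I_n * 'I_r}} :=
  [set m : {perm 'I_n * 'I_r} | [forall s, (m s != s) && (m (m s) == s)]].

(* The scalar obtained by contracting n copies of T along the pairing m: each
   pair {s, m s} contributes one factor g^{-1}, attached to the element of the
   pair of smaller rank. *)
Definition contraction (R : realType) (n r : nat)
    (T : curvature_data R -> ('I_r -> 'I_3) -> R)
    (m : {perm 'I_n * 'I_r}) (x : curvature_data R) : R :=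
  \sum_(f : {ffun 'I_n * 'I_r -> 'I_3})
    (\prod_(i < n) T x (fun j => f (i, j))) *
    \prod_(s : 'I_n * 'I_r | (enum_rank s < enum_rank (m s))%N)
       invmx (metric x) (f s) (f (m s)).

Definition lin_indep (R : realType) (X : Type) (I : finType)
    (F : I -> X -> R) (A : {set I}) : Prop :=
  forall c : I -> R, (forall x, \sum_(i in A) c i * F i x = 0) ->
  forall i, i \in A -> c i = 0.

(* The largest number of linearly independent members of (F i)_{i in P}, that
   is, the dimension of the space of functions that they span. *)
Definition max_indep (R : realType) (X : Type) (I : finType)
    (F : I -> X -> R) (P : {set I}) : nat :=
  \max_(A : {set I} | (A \subset P) && `[< lin_indep F A >]) #|A|.

Definition num_riemann_densities (R : realType) (n : nat) : nat :=
  max_indep (@contraction R n 4 (@riemann_tensor R)) (pairings n 4).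

Definition num_ricci_densities (R : realType) (n : nat) : nat :=
  max_indep (@contraction R n 2 (@ricci_tensor R)) (pairings n 2).

(* Main.v *)
(* Write h for the inverse metric, r for the Ricci tensor and t_k = tr (r h)^k.

   In dimension three the Riemann tensor is a polynomial in g, r and t_1, so a
   contraction of n Riemann tensors is a combination of networks of metrics and
   Ricci tensors joined by inverse metrics.  Summing out the two indices of one
   metric or Ricci tensor either merges two chains h (r h)^k, or closes a chain
   and splits off a factor t_k; hence every contraction is a combination of
   products of t_k's of total weight n, and by Cayley-Hamilton a combination of
   the t_1^i t_2^j t_3^k with i + 2j + 3k = n.

   Conversely, wiring n Ricci tensors into i cycles of length 1, j of length 2
   and k of length 3 gives a nonzero multiple of t_1^i t_2^j t_3^k (each Ricci
   tensor being obtained by contracting two slots of a Riemann tensor), and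
   (t_1, t_2, t_3) takes every value in R^3, so these monomials are independent.
   Their number N(n) is that of the pairs (j, k) with 2j + 3k <= n; it satisfies
   N(n + 3) = N(n) + floor((n + 3) / 2) + 1, from which the formulas follow by
   6-step induction. *)

Require Import Defs.
From mathcomp Require Import all_boot all_order all_algebra all_fingroup.
From mathcomp Require Import boolp reals trigo.
From mathcomp Require Import ring lra zify.

Set Implicit Arguments.
Unset Strict Implicit.
Unset Printing Implicit Defensive.

Import Order.TTheory GRing.Theory Num.Theory.
Local Open Scope ring_scope.

(** * Tensor networks *)

Section Networks.

Variables (V D : finType).

Definition upd (f : {ffun V -> D}) (u : V) (a : D) : {ffun V -> D} :=
  [ffun z => if z == u then a else f z].

Lemma upd_same f u a : upd f u a u = a.
Proof. by rewrite ffunE eqxx. Qed.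

Lemma upd_other f u a z : z != u -> upd f u a z = f z.
Proof. by rewrite ffunE => /negbTE ->. Qed.

Lemma upd_id f u : upd f u (f u) = f.
Proof. by apply/ffunP => z; rewrite ffunE; case: eqP => // ->. Qed.

Lemma upd_upd f u a b : upd (upd f u a) u b = upd f u b.
Proof. by apply/ffunP => z; rewrite !ffunE; case: eqP. Qed.

(** Exchanging a value [a] with the value of [f] at [u] permutes the pairs [(f, a)]. A vertex is
    thus summed out without shrinking [V], at the price of a factor [#|D|]. *)
Lemma sum_upd (K : nmodType) (u : V) (G : {ffun V -> D} -> K) :
  (\sum_f G f) *+ #|D| = \sum_f \sum_a G (upd f u a).
Proof.
pose sw (p : {ffun V -> D} * D) := (upd p.1 u p.2, p.1 u).
have swK : involutive sw.
  by case=> f a; rewrite /sw /= upd_same upd_upd upd_id.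
rewrite pair_big (reindex_inj (inv_inj swK)) /= .
rewrite (eq_bigr (fun p => G p.1)); last first.
  by move=> [f a] _; rewrite /sw /= upd_upd upd_id.
rewrite -(pair_big xpredT xpredT (fun f a => G f)) /= -sumrMnl.
by apply: eq_bigr => f _; rewrite sumr_const.
Qed.


Lemma sum_upd2 (K : nmodType) (u v : V) (G : {ffun V -> D} -> K) :
  (\sum_f G f) *+ (#|D| * #|D|) =
  \sum_f \sum_a \sum_b G (upd (upd f u a) v b).
Proof. by rewrite mulrnA (sum_upd v) (sum_upd u). Qed.

Definition indep_of (K : Type) (u : V) (r : {ffun V -> D} -> K) :=
  forall f a, r (upd f u a) = r f.

Section Edges.

Variable T : eqType.

Definition ends (L : seq (V * V * T)) : seq V :=
  flatten [seq [:: e.1.1; e.1.2] | e <- L].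

Lemma ends_cons e L : ends (e :: L) = [:: e.1.1, e.1.2 & ends L].
Proof. by []. Qed.

Lemma ends_cat L1 L2 : ends (L1 ++ L2) = ends L1 ++ ends L2.
Proof. by rewrite /ends map_cat flatten_cat. Qed.

Definition edge_prod (K : comPzSemiRingType) (E : T -> D -> D -> K)
    (L : seq (V * V * T)) (f : {ffun V -> D}) : K :=
  \prod_(e <- L) E e.2 (f e.1.1) (f e.1.2).

Lemma edge_prod_cons K E e L f :
  @edge_prod K E (e :: L) f = E e.2 (f e.1.1) (f e.1.2) * edge_prod E L f.
Proof. exact: big_cons. Qed.

Lemma edge_prod_cat K E L1 L2 f :
  @edge_prod K E (L1 ++ L2) f = edge_prod E L1 f * edge_prod E L2 f.
Proof. exact: big_cat. Qed.

Lemma indep_edge_prod K E L u :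
  u \notin ends L -> indep_of u (@edge_prod K E L).
Proof.
move=> uL f a; elim: L uL => [_|[[v w] k] L IH]; first by rewrite /edge_prod !big_nil.
rewrite ends_cons !inE !negb_or => /and3P[uv uw uL].
by rewrite !edge_prod_cons /= !upd_other 1?eq_sym // IH.
Qed.

(* A network whose edges carry symmetric matrices may be read with any edge
   at [u] first and oriented away from [u]. *)
Lemma pick_edge (wt : T -> nat) L u : u \in ends L ->
  exists w k L',
    [/\ perm_eq (ends L) [:: u, w & ends L'],
        (\sum_(e <- L) wt e.2 = wt k + \sum_(e <- L') wt e.2)%N
      & forall (K : comPzSemiRingType) (E : T -> D -> D -> K),
          (forall t a b, E t a b = E t b a) ->
          forall f, edge_prod E L f = E k (f u) (f w) * edge_prod E L' f].
Proof.
elim: L => [|[[v w] k] L IH] //; rewrite ends_cons !inE /=.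
have [-> _|nuv] /= := eqVneq u v.
  by exists w, k, L; split=> [||K E _ f]; rewrite ?big_cons ?edge_prod_cons.
have [-> _|nuw] /= := eqVneq u w.
  exists v, k, L; split=> [||K E Es f]; rewrite ?big_cons ?edge_prod_cons //=.
    by rewrite ?ends_cons; apply/seq.permP => P /=; lia.
  by rewrite Es.
case/IH => w' [k' [L' [pL wL eL]]]; exists w', k', ((v, w, k) :: L'); split.
- apply: (@perm_trans _ [:: v, w, u, w' & ends L']); first by rewrite !perm_cons.
  by rewrite ?ends_cons; apply/seq.permP => P /=; lia.
- by rewrite !big_cons wL addnCA.
- by move=> K E Es f; rewrite !edge_prod_cons (eL _ _ Es) mulrCA.
Qed.

End Edges.


(** * Summing out the two ends of an edge *)

Section Contract.

Variables (K : comPzRingType) (A : bool -> D -> D -> K) (E : nat -> D -> D -> K).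
Variable t : nat -> K.
Hypothesis E_sym : forall k a b, E k a b = E k b a.
Hypothesis E_loop : forall c k, \sum_a \sum_b A c a b * E k a b = t (k + c).
Hypothesis E_merge : forall c k l x y,
  \sum_a \sum_b A c a b * (E k a x * E l b y) = E (k + c + l) x y.

Lemma loop_sum u v c k (r : {ffun V -> D} -> K) :
  u != v -> indep_of u r -> indep_of v r ->
  (\sum_(f : {ffun V -> D}) A c (f u) (f v) * E k (f u) (f v) * r f) *+ (#|D| * #|D|) =
  t (k + c) * \sum_f r f.
Proof.
move=> uv ru rv; rewrite (sum_upd2 u v) mulr_sumr; apply: eq_bigr => f _.
rewrite -E_loop mulr_suml; apply: eq_bigr => a _.
rewrite mulr_suml; apply: eq_bigr => b _.
by rewrite upd_same upd_other // upd_same rv ru.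
Qed.

(** Updates at [u] and [v] leave the values at [w] and [w'] alone, so [E_merge] applies with these
    values as its outer indices. *)
Lemma merge_sum u v w w' c k l (r : {ffun V -> D} -> K) :
  uniq [:: u; v; w; w'] -> indep_of u r -> indep_of v r ->
  (\sum_(f : {ffun V -> D}) A c (f u) (f v) * (E k (f u) (f w) * E l (f v) (f w')) * r f)
    *+ (#|D| * #|D|) =
  \sum_(f : {ffun V -> D}) E (k + c + l) (f w) (f w') * r f.
Proof.
rewrite /= !inE !negb_or andbT.
move=> /andP[/and3P[uv uw uw'] /andP[/andP[vw vw'] ww']] ru rv.
rewrite (sum_upd2 u v); apply: eq_bigr => f _.
rewrite -E_merge mulr_suml; apply: eq_bigr => a _.
rewrite mulr_suml; apply: eq_bigr => b _.
by rewrite upd_same rv ru !(@upd_other _ v _ w, @upd_other _ v _ w', @upd_other _ v _ u,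
     @upd_other _ u _ w, @upd_other _ u _ w') ?upd_same // eq_sym.
Qed.

End Contract.

End Networks.

Arguments ends : simpl never.

(** * The curvature in dimension three *)

Lemma sum3 (K : nmodType) (F : 'I_3 -> K) : \sum_(i < 3) F i = F 0 + F 1 + F 2.
Proof.
rewrite !big_ord_recl big_ord0 addr0 addrA.
by congr (F _ + F _ + F _); apply: val_inj.
Qed.

(** Case analysis producing the numerals used in matrix entries instead of [Ordinal] terms. *)
Lemma ord3P (P : 'I_3 -> Prop) : P 0 -> P 1 -> P 2 -> forall i, P i.
Proof.
move=> P0 P1 P2 [[|[|[|//]]] i3].
- by rewrite (_ : Ordinal _ = 0) //; apply: val_inj.
- by rewrite (_ : Ordinal _ = 1) //; apply: val_inj.
- by rewrite (_ : Ordinal _ = 2) //; apply: val_inj.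
Qed.

Lemma ord3E : ((0 == 0 :> 'I_3) = true) * ((1 == 1 :> 'I_3) = true) *
  ((2 == 2 :> 'I_3) = true) * ((0 == 1 :> 'I_3) = false) *
  ((0 == 2 :> 'I_3) = false) * ((1 == 0 :> 'I_3) = false) *
  ((1 == 2 :> 'I_3) = false) * ((2 == 0 :> 'I_3) = false) *
  ((2 == 1 :> 'I_3) = false).
Proof. by []. Qed.

(** The elementary symmetric functions are written through power traces by Newton's identities; the
    factor 6 clears their denominators, so the identity holds over any nontrivial commutative
    ring. *)
Lemma cayley_hamilton3 (K : comNzRingType) (M : 'M[K]_3) :
  6%:R *: M ^+ 3 = 6%:R *: (\tr M *: M ^+ 2)
    - 3%:R *: ((\tr M ^+ 2 - \tr (M ^+ 2)) *: M)
    + (\tr M ^+ 3 - 3%:R * \tr M * \tr (M ^+ 2) + 2%:R * \tr (M ^+ 3))%:M.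
Proof.
rewrite /mxtrace !sum3 !(exprS M) !expr0 !mulr1 -!mulmxE.
apply/matrixP; elim/ord3P; elim/ord3P; rewrite !(mxE, sum3) !ord3E ?mulr1n ?mulr0n;
  move: (M 0 0) (M 0 1) (M 0 2) (M 1 0) (M 1 1) (M 1 2) (M 2 0) (M 2 1) (M 2 2);
  move=> *; ring.
Qed.

(** Cayley-Hamilton multiplied by [M ^+ k], then traced. *)
Lemma newton3 (K : comNzRingType) (M : 'M[K]_3) k :
  6%:R * \tr (M ^+ (k + 3)) = 6%:R * (\tr M * \tr (M ^+ (k + 2)))
    - 3%:R * ((\tr M ^+ 2 - \tr (M ^+ 2)) * \tr (M ^+ (k + 1)))
    + (\tr M ^+ 3 - 3%:R * \tr M * \tr (M ^+ 2) + 2%:R * \tr (M ^+ 3))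
      * \tr (M ^+ k).
Proof.
rewrite -mxtraceZ exprD scalerAr cayley_hamilton3 mulrDr mulrBr -!scalerAr.
by rewrite -scalemx1 -scalerAr mulr1 -exprSr -exprD addn1
  mxtraceD raddfB /= !mxtraceZ.
Qed.

(** * Chains of inverse metrics and Ricci tensors *)

Section ChainMatrices.

Variables (K : comNzRingType) (g h r : 'M[K]_3).
Hypotheses (gh : g *m h = 1%:M) (hg : h *m g = 1%:M).
Hypotheses (hT : h^T = h) (rT : r^T = r).

Definition chain (k : nat) : 'M[K]_3 := h *m (r *m h) ^+ k.

(** Coerced to [nat], the boolean is the curvature order of the matrix, so that it can be added to
    exponents as in [k + c]. *)
Definition gr (c : bool) : 'M[K]_3 := if c then r else g.

(** The word h r h ... r h is a palindrome in symmetric matrices. *)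
Lemma trmx_chain k : (chain k)^T = chain k.
Proof.
rewrite /chain; elim: k => [|k IH]; first by rewrite expr0 mulmx1.
by rewrite {1}exprSr -mulmxE mulmxA trmx_mul IH trmx_mul hT rT
  exprS -mulmxE !mulmxA.
Qed.

Lemma chain_gr c k : gr c *m chain k = (r *m h) ^+ (k + c).
Proof.
rewrite /chain mulmxA addnC; case: c; first by rewrite exprS.
by rewrite gh mul1mx.
Qed.

Lemma chain_merge c k l : chain k *m gr c *m chain l = chain (k + c + l).
Proof. by rewrite -mulmxA chain_gr /chain -mulmxA mulmxE -exprD addnAC addnA. Qed.

Lemma chain_sym k a b : chain k a b = chain k b a.
Proof. by rewrite -[in LHS]trmx_chain mxE. Qed.

Lemma chain_loop_sum c k :
  \sum_a \sum_b gr c a b * chain k a b = \tr ((r *m h) ^+ (k + c)).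
Proof.
rewrite -chain_gr; apply: eq_bigr => a _; rewrite mxE.
by apply: eq_bigr => b _; rewrite chain_sym.
Qed.

Lemma chain_merge_sum c k l x y :
  \sum_a \sum_b gr c a b * (chain k a x * chain l b y) = chain (k + c + l) x y.
Proof.
rewrite -chain_merge [RHS]mxE exchange_big; apply: eq_bigr => b _.
rewrite [(_ *m _) x b]mxE mulr_suml; apply: eq_bigr => a _.
by rewrite (chain_sym k x a) mulrCA mulrA.
Qed.

End ChainMatrices.

(** * Inverse and minors of a symmetric matrix of size 3 *)

Section Inverse3.

Variables (K : fieldType) (g h : 'M[K]_3).
Hypotheses (hg : h *m g = 1%:M) (hT : h^T = h).

Definition sym_det3 (h : 'M[K]_3) : K :=
  h 0 0 * h 1 1 * h 2 2 + h 0 1 * h 1 2 * h 0 2 *+ 2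
  - h 0 0 * h 1 2 ^+ 2 - h 1 1 * h 0 2 ^+ 2 - h 2 2 * h 0 1 ^+ 2.

Lemma det_sym3 : \det h = sym_det3 h.
Proof.
have hs i j : h i j = h j i by rewrite -[in LHS]hT mxE.
(* Cofactor expansion produces lifted ordinals; indexing the entries by natural numbers lets them
   reduce by computation. *)
have [H hE] : exists H : nat -> nat -> K, forall i j : 'I_3, h i j = H i j.
  by exists (fun i j => h (inord i) (inord j)) => i j; rewrite !inord_val.
have Hs i j : (i < 3 -> j < 3 -> H i j = H j i)%N.
  by move=> i3 j3; have := hs (Ordinal i3) (Ordinal j3); rewrite !hE.
have [v1 v2] : (1 : 'I_3) = 1%N :> nat /\ (2 : 'I_3) = 2%N :> nat by [].
rewrite (expand_det_row _ 0) sum3 /cofactor.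
rewrite !(expand_det_row _ 0) !big_ord_recl !big_ord0 /cofactor.
rewrite !det_mx11 !mxE /sym_det3 !hE /= ?v1 ?v2 /bump /=.

rewrite (Hs 1 0)%N // (Hs 2 0)%N // (Hs 2 1)%N //.
rewrite (_ : (1 %% 3 + 1 %% 3) %% 3 = 2)%N // (_ : 1 %% 3 = 1)%N //=.
rewrite ?(exprS, expr0). ring.
Qed.

Lemma det_sym3_neq0 : sym_det3 h != 0.
Proof.
rewrite -det_sym3; have /mulmx1_unit[] := hg.
by rewrite unitmxE unitfE.
Qed.

(** Cramer's rule: [d] times the inverse is the adjugate. In the proof the Kronecker deltas are
    expanded as entries of [h *m g], which leaves polynomial identities. *)
Lemma inv_sym3 :
  let d := sym_det3 h in
  [/\ d * g 0 0 = h 1 1 * h 2 2 - h 1 2 ^+ 2,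
      d * g 1 1 = h 0 0 * h 2 2 - h 0 2 ^+ 2,
      d * g 2 2 = h 0 0 * h 1 1 - h 0 1 ^+ 2
    & [/\ d * g 0 1 = h 0 2 * h 1 2 - h 0 1 * h 2 2,
      d * g 0 2 = h 0 1 * h 1 2 - h 0 2 * h 1 1
    & d * g 1 2 = h 0 1 * h 0 2 - h 1 2 * h 0 0]].
Proof.
move=> d.
have hs i j : h i j = h j i by rewrite -[in LHS]hT mxE.
have e i j : h i 0 * g 0 j + h i 1 * g 1 j + h i 2 * g 2 j = (i == j)%:R.
  by move/matrixP/(_ i j): hg; rewrite !mxE sum3.
have E0 j : d * g 0 j = (h 1 1 * h 2 2 - h 1 2 ^+ 2) * (0 == j)%:R
    + (h 0 2 * h 1 2 - h 0 1 * h 2 2) * (1 == j)%:R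
    + (h 0 1 * h 1 2 - h 0 2 * h 1 1) * (2 == j)%:R.
  by rewrite -!e /d /sym_det3 (hs 1 0) (hs 2 0) (hs 2 1); ring.
have E1 j : d * g 1 j = (h 0 2 * h 1 2 - h 0 1 * h 2 2) * (0 == j)%:R
    + (h 0 0 * h 2 2 - h 0 2 ^+ 2) * (1 == j)%:R
    + (h 0 1 * h 0 2 - h 1 2 * h 0 0) * (2 == j)%:R.
  by rewrite -!e /d /sym_det3 (hs 1 0) (hs 2 0) (hs 2 1); ring.
have E2 j : d * g 2 j = (h 0 1 * h 1 2 - h 0 2 * h 1 1) * (0 == j)%:R
    + (h 0 1 * h 0 2 - h 1 2 * h 0 0) * (1 == j)%:R
    + (h 0 0 * h 1 1 - h 0 1 ^+ 2) * (2 == j)%:R.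
  by rewrite -!e /d /sym_det3 (hs 1 0) (hs 2 0) (hs 2 1); ring.
by rewrite !(E0, E1, E2) !ord3E !(mulr1, mulr0, addr0, add0r).
Qed.

(** Jacobi's complementary minors. Multiplying once more by [d] turns both factors of each product
    into adjugate entries of [h]. *)
Lemma inv_minors3 :
  let d := sym_det3 h in
  [/\ d * (g 0 0 * g 1 1 - g 0 1 ^+ 2) = h 2 2,
      d * (g 0 0 * g 2 2 - g 0 2 ^+ 2) = h 1 1,
      d * (g 1 1 * g 2 2 - g 1 2 ^+ 2) = h 0 0
    & [/\ d * (g 0 0 * g 1 2 - g 0 2 * g 0 1) = - h 1 2,
      d * (g 0 1 * g 1 2 - g 0 2 * g 1 1) = h 0 2
    & d * (g 0 1 * g 2 2 - g 0 2 * g 1 2) = - h 0 1]].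
Proof.
have dn0 := det_sym3_neq0.
have /= := inv_sym3; set d := sym_det3 h => -[d00 d11 d22 [d01 d02 d12]] /=.
have cancel x y : d ^+ 2 * x = d * y -> d * x = y.
  by rewrite expr2 -mulrA => /(mulfI dn0).
have expand a b c e : d ^+ 2 * (a * b - c * e) = d * a * (d * b) - d * c * (d * e).
  by ring.
split; [..|split]; apply: cancel; rewrite ?(expr2 (g _ _)) expand
  !(d00, d11, d22, d01, d02, d12) /d /sym_det3; ring.
Qed.

End Inverse3.

(** * The Riemann tensor recovered from the Ricci tensor *)

Section Curvature3.

Variables (K : numFieldType) (g h : 'M[K]_3).
Variable T : 'I_3 -> 'I_3 -> 'I_3 -> 'I_3 -> K.
Hypotheses (hg : h *m g = 1%:M) (gT : g^T = g) (hT : h^T = h).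
Hypothesis T21 : forall a b c d, T b a c d = - T a b c d.
Hypothesis T43 : forall a b c d, T a b d c = - T a b c d.
Hypothesis T3412 : forall a b c d, T c d a b = T a b c d.

(** The Kulkarni-Nomizu product of [g] with the three-dimensional Schouten tensor [r - (s / 4) g],
    that is, a curvature tensor without Weyl part. *)
Definition schouten_tensor (g r : 'M[K]_3) (s : K) (a b c d : 'I_3) : K :=
  g a c * r b d - g a d * r b c - g b c * r a d + g b d * r a c
  - 2^-1 * s * (g a c * g b d - g a d * g b c).

Let r : 'M[K]_3 := \matrix_(b, d) \sum_a \sum_c h a c * T a b c d.
Let s : K := \sum_a \sum_c h a c * r a c.

(* The six independent components of [T], multiplied by [det h], give
   polynomial identities in [h] because all 2-minors of [g] do. *)
Lemma riemann_from_ricci a b c d : T a b c d = schouten_tensor g r s a b c d.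
Proof.
have hs i j : h i j = h j i by rewrite -[in LHS]hT mxE.
have gs i j : g i j = g j i by rewrite -[in LHS]gT mxE.
have half (x : K) : x = - x -> x = 0.
  by move/eqP; rewrite -subr_eq0 opprK -mulr2n mulrn_eq0 => /eqP.
have T11 i j k : T i i j k = 0 by apply/half.
have T33 i j k : T i j k k = 0 by apply/half.
have rs i j : r i j = r j i.
  rewrite !mxE exchange_big; apply: eq_bigr => x _; apply: eq_bigr => y _.
  by rewrite hs T3412.
(* [T] and [U] have the same antisymmetries and pair symmetry, so agreement on the index pairs 01,
   02 and 12 suffices. *)
pose U := schouten_tensor g r s.
have U21 i j k l : U j i k l = - U i j k l.
  by rewrite /U /schouten_tensor; ring.
have U43 i j k l : U i j l k = - U i j k l.
  by rewrite /U /schouten_tensor; ring.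
have U3412 i j k l : U k l i j = U i j k l.
  rewrite /U /schouten_tensor (gs k i) (gs l j) (gs k j) (gs l i).
  by rewrite (rs k i) (rs l j) (rs k j) (rs l i); ring.
have U11 i j k : U i i j k = 0 by apply/half.
have U33 i j k : U i j k k = 0 by apply/half.
rewrite -/(U a b c d).
have := inv_sym3 hg hT; have := inv_minors3 hg hT; have := det_sym3_neq0 hg hT.
have [dd ddE] : exists d, d = sym_det3 h by exists (sym_det3 h).
rewrite /= -ddE => dn0 [m22 m11 m00 [m12 m02 m01]] [g00 g11 g22 [g01 g02 g12]].
have key : [/\ T 0 1 0 1 = U 0 1 0 1, T 0 2 0 2 = U 0 2 0 2, T 1 2 1 2 = U 1 2 1 2
   & [/\ T 0 1 0 2 = U 0 1 0 2, T 0 1 1 2 = U 0 1 1 2 & T 0 2 1 2 = U 0 2 1 2]].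
  (* One factor [dd] per term is enough: it turns entries of [g] into 2-minors of [h], and 2-minors
     of [g] into entries of [h]. *)
  have Uexp i j k l : dd * U i j k l = dd * g i k * r j l - dd * g i l * r j k
      - dd * g j k * r i l + dd * g j l * r i k
      - 2^-1 * s * (dd * (g i k * g j l - g i l * g j k)).
    by rewrite /U /schouten_tensor; ring.
  have sE : s = h 0 0 * r 0 0 + h 1 1 * r 1 1 + h 2 2 * r 2 2
      + (h 0 1 * r 0 1 + h 0 2 * r 0 2 + h 1 2 * r 1 2) *+ 2.
    rewrite /s !sum3 (hs 1 0) (hs 2 0) (hs 2 1) (rs 1 0) (rs 2 0) (rs 2 1).
    by ring.
  have rval i j : r i j = \sum_a \sum_c h a c * T a i c j by rewrite mxE.
  have T43' i j := (T43 i j 0 1, T43 i j 0 2, T43 i j 1 2).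
  have TE := (T11, T33, T21 0 1, T21 0 2, T21 1 2, T43',
    T3412 0 1 0 2, T3412 0 1 1 2, T3412 0 2 1 2).
  move: (rval 0 0) (rval 1 1) (rval 2 2) (rval 0 1) (rval 0 2) (rval 1 2).
  rewrite !sum3 !TE (hs 1 0) (hs 2 0) (hs 2 1) => r00 r11 r22 r01 r02 r12.
  by split; [..|split]; apply: (mulfI dn0); rewrite Uexp ?(gs 1 0) ?(gs 2 0)
      ?(gs 2 1) -?expr2 ?(rs 1 0) ?(rs 2 0) ?(rs 2 1)
      !(m22, m11, m00, m12, m02, m01, g00, g11, g22, g01, g02, g12)
      sE r00 r11 r22 r01 r02 r12 ddE /sym_det3; field.
case: key => k1 k2 k3 [k4 k5 k6].
by move: a b c d; do 4!elim/ord3P; rewrite ?T11 ?T33 ?U11 ?U33 //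
  ?(T21 0 1) ?(T21 0 2) ?(T21 1 2) ?(U21 0 1) ?(U21 0 2) ?(U21 1 2)
  ?(T43 _ _ 0 1) ?(T43 _ _ 0 2) ?(T43 _ _ 1 2)
  ?(U43 _ _ 0 1) ?(U43 _ _ 0 2) ?(U43 _ _ 1 2)
  ?(T3412 0 1 0 2) ?(T3412 0 1 1 2) ?(T3412 0 2 1 2)
  ?(U3412 0 1 0 2) ?(U3412 0 1 1 2) ?(U3412 0 2 1 2)
  ?k1 ?k2 ?k3 ?k4 ?k5 ?k6.
Qed.

End Curvature3.

(** * Curvature data in matrix form and their traces *)

Section CurvatureData.

Variable R : realType.
Implicit Type x : curvature_data R.

Definition inv_metric x : 'M[R]_3 := invmx (metric x).
Definition ricci_mx x : 'M[R]_3 := \matrix_(b, d) ricci x b d.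
Definition trace_pow k x : R := \tr ((ricci_mx x *m inv_metric x) ^+ k).

Lemma metric_trmx x : (metric x)^T = metric x.
Proof.
have [P _ ->] := metric_lorentzian x.
by rewrite !trmx_mul trmxK /minkowski tr_diag_mx mulmxA.
Qed.

Lemma metric_unit x : metric x \in unitmx.
Proof.
have [P Pu ->] := metric_lorentzian x; rewrite !unitmx_mul unitmx_tr Pu andbT /=.
rewrite unitmxE det_diag unitfE; apply/prodf_neq0 => i _; rewrite mxE.
by case: ifP; rewrite ?oppr_eq0 oner_eq0.
Qed.

Lemma mul_metric_inv x : metric x *m inv_metric x = 1%:M.
Proof. exact/mulmxV/metric_unit. Qed.

Lemma mul_inv_metric x : inv_metric x *m metric x = 1%:M.
Proof. exact/mulVmx/metric_unit. Qed.

Lemma inv_metric_trmx x : (inv_metric x)^T = inv_metric x.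
Proof. by rewrite /inv_metric trmx_inv metric_trmx. Qed.

Lemma inv_metric_sym x a b : inv_metric x a b = inv_metric x b a.
Proof. by rewrite -[in LHS]inv_metric_trmx mxE. Qed.

Lemma ricci_mx_trmx x : (ricci_mx x)^T = ricci_mx x.
Proof.
have [_ _ pairs _] := riemann_symP x.
apply/matrixP => b d; rewrite !mxE /ricci exchange_big.
apply: eq_bigr => a _; apply: eq_bigr => c _.
by rewrite -/(inv_metric x) inv_metric_sym pairs.
Qed.

Lemma riemannE x a b c d :
  riemann x a b c d = schouten_tensor (metric x) (ricci_mx x) (trace_pow 1 x) a b c d.
Proof.
have [T21 T43 T3412 _] := riemann_symP x.
rewrite (riemann_from_ricci (mul_inv_metric x) (metric_trmx x)
  (inv_metric_trmx x) T21 T43 T3412).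
congr schouten_tensor; rewrite /trace_pow expr1 /mxtrace exchange_big.
apply: eq_bigr => c' _; rewrite mxE; apply: eq_bigr => a' _.
by rewrite mulrC -/(ricci_mx x) -[in LHS](ricci_mx_trmx x) mxE.
Qed.

(** Supplies curvature data with a prescribed Ricci tensor. *)
Lemma schouten_symmetries (g r : 'M[R]_3) s : g^T = g -> r^T = r ->
  riemann_symmetries (schouten_tensor g r s).
Proof.
move=> gT rT.
have gs i j : g i j = g j i by rewrite -[in LHS]gT mxE.
have rs i j : r i j = r j i by rewrite -[in LHS]rT mxE.
split=> a b c d; rewrite /schouten_tensor.
- by ring.
- by ring.
- by rewrite (gs c a) (gs d b) (gs c b) (gs d a)
    (rs c a) (rs d b) (rs c b) (rs d a); ring.
- by rewrite (gs d b) (gs c b) (gs d c) (rs d b) (rs c b) (rs d c); ring.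
Qed.

(** The quadratic form $2 x_0 x_2 + x_1^2$ of a null frame. Being indefinite, it allows Ricci
    operators with non-real eigenvalues, hence negative values of [trace_pow 2]. *)
Definition antidiag3 : 'M[R]_3 := \matrix_(i, j) ((i + j == 2)%N)%:R.

Lemma antidiag3K : antidiag3 *m antidiag3 = 1%:M.
Proof.
by apply/matrixP; do 2!elim/ord3P; rewrite !(mxE, sum3) /=
  ?(mulr0, mulr1, addr0, add0r).
Qed.

Lemma antidiag3_tr : antidiag3^T = antidiag3.
Proof. by apply/matrixP => i j; rewrite !mxE addnC. Qed.

Lemma lorentzian_antidiag3 : lorentzian antidiag3.
Proof.
pose s : R := Num.sqrt 2^-1.
have ss : s * s = 2^-1 by rewrite -expr2 sqr_sqrtr // invr_ge0 ler0n.
(* Read off from $2 x_0 x_2 = -(x_0 - x_2)^2/2 + (x_0 + x_2)^2/2$. *)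
pose P : 'M[R]_3 := \matrix_(i, j)
  if i == 0 then s * (j == 0)%:R - s * (j == 2)%:R
  else if i == 1 then (j == 1)%:R else s * (j == 0)%:R + s * (j == 2)%:R.
have JP : antidiag3 = P^T *m minkowski R *m P.
  apply/matrixP; do 2!elim/ord3P; rewrite /minkowski ?(mxE, sum3) ?ord3E /=;
    rewrite ?(mulr0n, mulr1n, mulr0, mulr1, addr0, add0r, mul0r, subr0, sub0r);
    rewrite ?(oppr0, mul0r, mulr0, add0r, mulrN, mulNr, mulr1, opprK, ss) //;
    by field.
exists P => //.
have : antidiag3 *m P^T *m minkowski R *m P = 1%:M.
  by rewrite -!mulmxA (mulmxA P^T) -JP antidiag3K.
by case/mulmx1_unit.
Qed.

(* Raising an index with [antidiag3] reverses the columns and gives a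
   Hessenberg Toeplitz matrix with diagonals c, b, a, 1: its first three power
   traces are triangular in a, b, c, hence arbitrary. *)
Definition toeplitz_ricci (a b c : R) : 'M[R]_3 :=
  \matrix_(i, j) nth 0 [:: c; b; a; 1; 0] (i + j).

Lemma toeplitz_ricci_tr a b c : (toeplitz_ricci a b c)^T = toeplitz_ricci a b c.
Proof. by apply/matrixP => i j; rewrite !mxE addnC. Qed.

(** The scalar [3 * a] is the trace of [toeplitz_ricci a b c] with respect to [antidiag3], which
    makes this matrix the actual Ricci tensor of the data. *)
Definition toeplitz_data (a b c : R) : curvature_data R :=
  CurvatureData lorentzian_antidiag3
    (schouten_symmetries (3 * a) antidiag3_tr (toeplitz_ricci_tr a b c)).

Lemma inv_metric_toeplitz a b c : inv_metric (toeplitz_data a b c) = antidiag3.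
Proof.
have /mulmx1_unit[_ Ju] := antidiag3K.
by rewrite /inv_metric /= -[LHS]mulmx1 -antidiag3K mulKmx.
Qed.

Lemma ricci_toeplitz a b c : ricci_mx (toeplitz_data a b c) = toeplitz_ricci a b c.
Proof.
apply/matrixP => i j; rewrite mxE /ricci -/(inv_metric _) inv_metric_toeplitz.
rewrite !sum3 /= /schouten_tensor.
have Js : (antidiag3 0 0 = 0) * (antidiag3 0 1 = 0) * (antidiag3 0 2 = 1) *
  (antidiag3 1 0 = 0) * (antidiag3 1 1 = 1) * (antidiag3 1 2 = 0) *
  (antidiag3 2 0 = 1) * (antidiag3 2 1 = 0) * (antidiag3 2 2 = 0).
  by do !split; rewrite mxE.
by move: i j; do 2!elim/ord3P; rewrite !Js ![toeplitz_ricci _ _ _ _ _]mxE /=; field.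
Qed.

Lemma trace_pow_surj t1 t2 t3 : exists x,
  [/\ trace_pow 1 x = t1, trace_pow 2 x = t2 & trace_pow 3 x = t3].
Proof.
(* Solution of the triangular system $t_1 = 3a$, $t_2 = 3a^2 + 4b$, $t_3 = 3a^3 + 12ab + 3c$. *)
pose a := t1 / 3; pose b := (t2 - 3 * a ^+ 2) / 4.
pose c := (t3 - 3 * a ^+ 3 - 12 * a * b) / 3.
exists (toeplitz_data a b c).
rewrite /trace_pow ricci_toeplitz inv_metric_toeplitz.
have -> : toeplitz_ricci a b c *m antidiag3 =
    \matrix_(i, j) nth 0 [:: c; b; a; 1; 0] (i + (2 - j)).
  apply/matrixP; do 2!elim/ord3P;
  by rewrite !(mxE, sum3) /= ?(mulr0, mulr1, addr0, add0r).
set M := \matrix_(i, j) _.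
rewrite !(exprS M) !expr0 !mulr1 /mxtrace !sum3 -!mulmxE.
by split; rewrite !(mxE, sum3) /= /c /b /a; field.
Qed.

End CurvatureData.

(** * Reduction of contractions to traces of powers of the Ricci operator *)

Section Homogeneous.

Variable R : realType.
Implicit Types (x : curvature_data R) (F : curvature_data R -> R).

Definition trace_mon (n : nat) (p : nat * nat) x : R :=
  trace_pow 1 x ^+ (n - (2 * p.1 + 3 * p.2)) * trace_pow 2 x ^+ p.1
  * trace_pow 3 x ^+ p.2.

(** A list with possible repetitions makes closure under sums and products immediate. The inequality
    ensures that the truncated exponent of [trace_pow 1] in [trace_mon] is the true one. *)
Definition homog (n : nat) F : Prop :=
  exists s : seq (R * (nat * nat)),
    all (fun q => (2 * q.2.1 + 3 * q.2.2 <= n)%N) s /\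
    forall x, F x = \sum_(q <- s) q.1 * trace_mon n q.2 x.

Lemma homog_ext n F F' : (forall x, F x = F' x) -> homog n F -> homog n F'.
Proof. by move=> eF [s [sn sF]]; exists s; split=> // x; rewrite -eF. Qed.

Lemma homogD n F F' : homog n F -> homog n F' -> homog n (fun x => F x + F' x).
Proof.
move=> [s [sn sF]] [s' [sn' sF']]; exists (s ++ s').
by rewrite all_cat sn sn'; split=> // x; rewrite big_cat /= -sF -sF'.
Qed.

Lemma homogM m n F F' :
  homog m F -> homog n F' -> homog (m + n) (fun x => F x * F' x).
Proof.
move=> [s [sn sF]] [s' [sn' sF']].
exists [seq (p.1 * q.1, (p.2.1 + q.2.1, p.2.2 + q.2.2)%N) | p <- s, q <- s'].
split.
  apply/allP => _ /allpairsP[[p q] /= [ps qs ->]] /=.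
  by have := allP sn _ ps; have := allP sn' _ qs => /= qn pn; lia.
move=> x; rewrite big_allpairs_dep /= sF sF' mulr_suml big_seq [RHS]big_seq.
apply: eq_bigr => -[c [j k]] ps; rewrite mulr_sumr big_seq [RHS]big_seq.
apply: eq_bigr => -[c' [j' k']] qs; rewrite /trace_mon /= !exprD.
have := allP sn _ ps; have := allP sn' _ qs => /= qn pn.
have -> : (m + n - (2 * (j + j') + 3 * (k + k')) =
  (m - (2 * j + 3 * k)) + (n - (2 * j' + 3 * k')))%N by lia.
by rewrite exprD; ring.
Qed.

Lemma homog_cst c : homog 0 (fun=> c).
Proof.
exists [:: (c, (0, 0)%N)]; split=> // x.
by rewrite big_seq1 /trace_mon !expr0 !mulr1.
Qed.

Lemma homogZ n c F : homog n F -> homog n (fun x => c * F x).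
Proof. exact: (homogM (homog_cst c)). Qed.

(** Strong induction, since Newton's recurrence calls on three earlier power traces. *)
Lemma homog_trace_pow k : homog k (trace_pow k).
Proof.
have hom1 : homog 1 (trace_pow 1).
  exists [:: (1, (0, 0)%N)]; split=> // x.
  by rewrite big_seq1 /trace_mon !expr0 mul1r !mulr1.
have hom2 : homog 2 (trace_pow 2).
  exists [:: (1, (1, 0)%N)]; split=> // x.
  by rewrite big_seq1 /trace_mon !expr0 mul1r !mulr1 mul1r.
have hom3 : homog 3 (trace_pow 3).
  exists [:: (1, (0, 1)%N)]; split=> // x.
  by rewrite big_seq1 /trace_mon !expr0 !mul1r.
have [m] := ubnP k; elim: m k => // m IH [|[|[|k]]] km //.
  (* Exponent 0 gives the trace of the identity. *)
  apply: homog_ext (homog_cst 3) => x.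
  by rewrite /trace_pow expr0 mxtrace1.
have h i : (i < 3)%N -> homog (k + i) (trace_pow (k + i)).
  by move=> i3; apply: IH; lia.
(* The three terms of Newton's recurrence, each of weight [k.+3]. *)
have H1 := homogM hom1 (h 2%N isT).
have H2 := homogM (homogD (homogM hom1 hom1) (homogZ (-1) hom2)) (h 1%N isT).
have H3 := homogM (homogD (homogD (homogM (homogM hom1 hom1) hom1)
  (homogZ (- 3) (homogM hom1 hom2))) (homogZ 2 hom3)) (h 0 isT).
move: H1 H2 H3; rewrite (_ : 1 + (k + 2) = k.+3)%N; last by lia.
rewrite (_ : 1 + 1 + (k + 1) = k.+3)%N; last by lia.
rewrite (_ : 1 + 1 + 1 + (k + 0) = k.+3)%N; last by lia.
move=> H1 H2 H3.
apply: homog_ext (homogD (homogD H1 (homogZ (- 2^-1) H2)) (homogZ 6^-1 H3)) => x.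
have := newton3 (ricci_mx x *m inv_metric x) k.
rewrite /trace_pow expr1 addn0 addn3 => e.
by apply: (mulfI (_ : 6 != 0)); rewrite ?pnatr_eq0 // e; field.
Qed.

End Homogeneous.

(** * Reduction of networks of metrics and Ricci tensors *)

Section Reduction.

Variables (R : realType) (V : finType).
Implicit Types (x : curvature_data R) (f : {ffun V -> 'I_3}).

(* A [site] is a metric or Ricci tensor; the link of weight [k] is the chain
   h (r h)^k of inverse metrics h and Ricci tensors r obtained by contracting
   sites away, so that a network of total weight [n] has curvature order [n]. *)
Definition site x (c : bool) (a b : 'I_3) : R := gr (metric x) (ricci_mx x) c a b.
Definition link x (k : nat) (a b : 'I_3) : R :=
  chain (inv_metric x) (ricci_mx x) k a b.

Definition network (L1 : seq (V * V * bool)) (L2 : seq (V * V * nat)) x : R :=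
  \sum_(f : {ffun V -> 'I_3}) edge_prod (site x) L1 f * edge_prod (link x) L2 f.

Lemma link_sym x k a b : link x k a b = link x k b a.
Proof. exact/chain_sym/ricci_mx_trmx/inv_metric_trmx. Qed.

Lemma site_link_loop x c k :
  \sum_a \sum_b site x c a b * link x k a b = trace_pow (k + c) x.
Proof.
exact: (chain_loop_sum (mul_metric_inv x) (inv_metric_trmx x) (ricci_mx_trmx x)).
Qed.

Lemma site_link_merge x c k l y z :
  \sum_a \sum_b site x c a b * (link x k a y * link x l b z) =
  link x (k + c + l) y z.
Proof.
exact: (chain_merge_sum (mul_metric_inv x) (inv_metric_trmx x) (ricci_mx_trmx x)).
Qed.

(** The vertices [u] and [v] meet no other edge and can be summed out; they remain in [V], whence
    the factor 9. *)
Lemma network_loop u v c k L1 L2 x :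
  u != v -> all (fun z => z \notin ends L1 ++ ends L2) [:: u; v] ->
  network ((u, v, c) :: L1) ((u, v, k) :: L2) x *+ 9 =
  trace_pow (k + c) x * network L1 L2 x.
Proof.
move=> uv; rewrite /= !mem_cat !negb_or andbT => /andP[/andP[u1 u2] /andP[v1 v2]].
pose r f := edge_prod (site x) L1 f * edge_prod (link x) L2 f.
rewrite -[trace_pow _ _]/((fun i => trace_pow i x) _) -[network L1 _ _]/(\sum_f r f).
rewrite -(loop_sum (t := fun i => trace_pow i x) (site_link_loop x) c k uv).
- rewrite card_ord; congr (_ *+ _); apply: eq_bigr => f _.
  by rewrite !edge_prod_cons mulrACA.
- by move=> f a; rewrite /r !indep_edge_prod.
- by move=> f a; rewrite /r !indep_edge_prod.
Qed.

Lemma network_merge u v w w' c k l L1 L2 x :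
  uniq [:: u; v; w; w'] -> all (fun z => z \notin ends L1 ++ ends L2) [:: u; v] ->
  network ((u, v, c) :: L1) [:: (u, w, k), (v, w', l) & L2] x *+ 9 =
  network L1 ((w, w', (k + c + l)%N) :: L2) x.
Proof.
move=> uw; rewrite /= !mem_cat !negb_or andbT => /andP[/andP[u1 u2] /andP[v1 v2]].
pose r f := edge_prod (site x) L1 f * edge_prod (link x) L2 f.
have -> : network L1 ((w, w', (k + c + l)%N) :: L2) x =
    \sum_(f : {ffun V -> 'I_3}) link x (k + c + l) (f w) (f w') * r f.
  by apply: eq_bigr => f _; rewrite edge_prod_cons mulrCA.
rewrite -(merge_sum (site_link_merge x) c k l uw).
- rewrite card_ord; congr (_ *+ _); apply: eq_bigr => f _.
  by rewrite !edge_prod_cons /r /=; ring.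
- by move=> f a; rewrite /r !indep_edge_prod.
- by move=> f a; rewrite /r !indep_edge_prod.
Qed.

Lemma network_eqr L1 L2 L2' x :
  (forall f, edge_prod (link x) L2 f = edge_prod (link x) L2' f) ->
  network L1 L2 x = network L1 L2' x.
Proof. by move=> e; apply: eq_bigr => f _; rewrite e. Qed.

(** Every end lies on exactly one site and one link, so the graph is a disjoint union of alternating
    cycles. Removing a site shortens or closes one of them and preserves the total weight. *)
Lemma homog_network (L1 : seq (V * V * bool)) (L2 : seq (V * V * nat)) :
  uniq (ends L1) -> perm_eq (ends L1) (ends L2) ->
  homog (\sum_(e <- L1) e.2 + \sum_(e <- L2) e.2) (network L1 L2).
Proof.
have div9 n F F' : homog n F' -> (forall x, F x *+ 9 = F' x) -> homog n F.
  move=> hF' e; apply: homog_ext (homogZ 9^-1 hF') => x.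
  by rewrite -e -(mulr_natl (F x)) mulKf ?pnatr_eq0.
elim: L1 L2 => [|[[u v] c] L1 IH] L2.
  (* Without sites there are no links either, and the network is the number of assignments. *)
  case: L2 => [|e L2] _ /perm_size //; rewrite /= => _; rewrite !big_nil.
  apply: homog_ext (homog_cst (\sum_(f : {ffun V -> 'I_3}) 1)) => x.
  by apply: eq_bigr => f _; rewrite /edge_prod !big_nil mulr1.
rewrite ends_cons /= => /andP[]; rewrite inE negb_or => /andP[uv u1] /andP[v1 uq1] p.
have uL2 : u \in ends L2 by rewrite -(perm_mem p) inE eqxx.
have [w [k [L2' [p2 -> e2]]]] := pick_edge 'I_3 id uL2.
have {p2 p} : perm_eq [:: u, v & ends L1] [:: u, w & ends L2'].
  exact: perm_trans p p2.
rewrite perm_cons big_cons /= => p.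
have u2 : u \notin ends L2'.
  have /perm_mem/(_ u) := p; rewrite !inE (negbTE uv) (negbTE u1) /=.
  by move/esym/negbT; rewrite negb_or => /andP[].
(* Either the link at [u] ends at [v] and closes a cycle, or [v] lies on a second link and the two
   links merge. *)
have [vw|vw] := eqVneq v w.
  move: p e2; rewrite -{w}vw perm_cons => p e2.
  have v2 : v \notin ends L2' by rewrite -(perm_mem p).
  have := homogM (homog_trace_pow _ (k + c)) (IH L2' uq1 p).
  have regroup a b : (k + c + (a + b) = c + a + (k + b))%N by lia.
  rewrite regroup; move/div9; apply => x; rewrite -(@network_loop u v) //=.
    congr (_ *+ _); apply: network_eqr => f.
    by rewrite edge_prod_cons (e2 _ _ (@link_sym x)).
  by rewrite !mem_cat !negb_or u1 u2 v1 v2.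
have : v \in ends L2' by have /perm_mem/(_ v) := p; rewrite !inE eqxx (negbTE vw).
move=> vL2; have [w' [l [L2'' [p2 -> e2']]]] := pick_edge 'I_3 id vL2.
have {}p : perm_eq (ends L1) [:: w, w' & ends L2''].
  rewrite -(perm_cons v); apply: perm_trans p _.
  apply: (@perm_trans _ [:: w, v, w' & ends L2'']); first by rewrite perm_cons.
  by apply/seq.permP => P /=; lia.
have uq2 : uniq [:: w, w' & ends L2''] by rewrite -(perm_uniq p).
have v2 : v \notin [:: w, w' & ends L2''] by rewrite -(perm_mem p).
have {}u2 : u \notin [:: w, w' & ends L2''] by rewrite -(perm_mem p).
have := IH ((w, w', k + c + l)%N :: L2'') uq1 p; rewrite big_cons /=.
have regroup a b : (a + (k + c + l + b) = c + a + (k + (l + b)))%N by lia.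
rewrite regroup; move/div9; apply => x; rewrite -(@network_merge u v).
- congr (_ *+ _); apply: network_eqr => f.
  by rewrite !edge_prod_cons /= (e2 _ _ (@link_sym x)) (e2' _ _ (@link_sym x)).
- move: u2 v2 uq2; rewrite /= !inE !negb_or => /and3P[-> -> _] /and3P[-> -> _].
  by rewrite uv => /andP[/andP[->]].
- move: u2 v2; rewrite /= !mem_cat !inE !negb_or u1 v1 => /and3P[_ _ ->].
  by move=> /and3P[_ _ ->].
Qed.

(** * Networks containing Riemann tensors *)

Definition ends4 (Q : seq ('I_4 -> V)) : seq V :=
  flatten [seq [:: q 0; q 1; q 2; q 3] | q <- Q].

Definition riemann_network (Q : seq ('I_4 -> V)) L1 L2 x : R :=
  \sum_(f : {ffun V -> 'I_3}) (\prod_(q <- Q) riemann_tensor x (fun j => f (q j)))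
    * (edge_prod (site x) L1 f * edge_prod (link x) L2 f).

(** Each term places two sites on the four indices; where both are metrics, [trace_pow 1] carries
    the curvature order. *)
Lemma riemannE_site x a b c d : riemann x a b c d =
  site x false a c * site x true b d
  + (-1) * (site x false a d * site x true b c)
  + (-1) * (site x false b c * site x true a d)
  + site x false b d * site x true a c
  + - 2^-1 * (trace_pow 1 x * (site x false a c * site x false b d))
  + 2^-1 * (trace_pow 1 x * (site x false a d * site x false b c)).
Proof. by rewrite riemannE /schouten_tensor /site /gr; ring. Qed.

(** Expanding one Riemann tensor replaces its four slots by two sites on the same slots, so the
    matching of sites with links persists along the induction on [Q]. *)
Lemma homog_riemann_network Q
    (L1 : seq (V * V * bool)) (L2 : seq (V * V * nat)) :
  uniq (ends4 Q ++ ends L1) -> perm_eq (ends4 Q ++ ends L1) (ends L2) ->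
  homog (size Q + \sum_(e <- L1) e.2 + \sum_(e <- L2) e.2) (riemann_network Q L1 L2).
Proof.
elim: Q L1 => [|q Q IH] L1.
  move=> uq p; apply: homog_ext (homog_network uq p) => x.
  by apply: eq_bigr => f _; rewrite big_nil mul1r.
set N := (size (q :: Q) + _ + _)%N => uq p.
pose Z i j c k l c' := riemann_network Q [:: (i, j, c), (k, l, c') & L1] L2.
have step i j (c : bool) k l (c' : bool) : perm_eq [:: i; j; k; l] [:: q 0; q 1; q 2; q 3] ->
    homog (size Q + (c + (c' + \sum_(e <- L1) e.2)) + \sum_(e <- L2) e.2)
      (Z i j c k l c').
  move=> pq; have pe : perm_eq
      (ends4 Q ++ ends [:: (i, j, c), (k, l, c') & L1])
      [:: q 0, q 1, q 2, q 3 & ends4 Q ++ ends L1].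
    rewrite !ends_cons /= perm_catC /=.
    apply/seq.permP => P; have /seq.permP/(_ P) /= := pq.
    by rewrite !count_cat; lia.
  have := IH [:: (i, j, c), (k, l, c') & L1].
  by rewrite !big_cons /=; apply; rewrite ?(perm_uniq pe) ?(permPl pe).
(* A metric and a Ricci site account for the full order; two metric sites fall short by one, which
   the factor [trace_pow 1] supplies. *)
have N1 : N = (size Q + (0 + (1 + \sum_(e <- L1) e.2)) + \sum_(e <- L2) e.2)%N.
  by rewrite /N /=; lia.
have N0 : N = (1 + (size Q + (0 + (0 + \sum_(e <- L1) e.2)) + \sum_(e <- L2) e.2))%N.
  by rewrite /N /=; lia.
have h1 i j k l : perm_eq [:: i; j; k; l] [:: q 0; q 1; q 2; q 3] ->
    homog N (Z i j false k l true) by rewrite N1; exact: (@step i j false k l true).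
have h0 i j k l : perm_eq [:: i; j; k; l] [:: q 0; q 1; q 2; q 3] ->
    homog N (fun x => trace_pow 1 x * Z i j false k l false x).
  by move=> /(@step i j false k l false); rewrite N0; apply/homogM/homog_trace_pow.
have H1 : homog N (Z (q 0) (q 2) false (q 1) (q 3) true).
  by apply: h1; apply/seq.permP => P /=; lia.
have H2 : homog N (Z (q 0) (q 3) false (q 1) (q 2) true).
  by apply: h1; apply/seq.permP => P /=; lia.
have H3 : homog N (Z (q 1) (q 2) false (q 0) (q 3) true).
  by apply: h1; apply/seq.permP => P /=; lia.
have H4 : homog N (Z (q 1) (q 3) false (q 0) (q 2) true).
  by apply: h1; apply/seq.permP => P /=; lia.
have H5 := h0 (q 0) (q 2) (q 1) (q 3).
have H6 := h0 (q 0) (q 3) (q 1) (q 2).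
apply: homog_ext (homogD (homogD (homogD (homogD (homogD H1 (homogZ (-1) H2))
  (homogZ (-1) H3)) H4) (homogZ (- 2^-1) (H5 _))) (homogZ 2^-1 (H6 _))).
- move=> x; rewrite /Z /riemann_network !mulr_sumr -!big_split /=.
  apply: eq_bigr => f _; rewrite big_cons /riemann_tensor riemannE_site.
  by rewrite !edge_prod_cons /=; ring.
- by apply/seq.permP => P /=; lia.
- by apply/seq.permP => P /=; lia.
Qed.

End Reduction.

(** * Pairings as edge lists *)

Section Pairings.

Variable V : finType.

Definition is_pairing (m : {perm V}) : bool :=
  [forall s, (m s != s) && (m (m s) == s)].

(** Links of weight 0 are inverse metrics. Each pair is listed once, from its end of smaller rank,
    as in [contraction]. *)
Definition pairing_edges (m : {perm V}) : seq (V * V * nat) :=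
  [seq (s, m s, 0%N) | s <- enum V & (enum_rank s < enum_rank (m s))%N].

Lemma ends_pairing_edges m : is_pairing m -> perm_eq (enum V) (ends (pairing_edges m)).
Proof.
move=> /forallP pm; apply/seq.permP => P.
have mm s : m (m s) = s by case/andP: (pm s) => _ /eqP.
rewrite /ends /pairing_edges -!map_comp count_flatten -!map_comp sumnE !big_map.
rewrite big_filter big_enum_cond /=.
under eq_bigr do rewrite addn0.
rewrite big_split /= -sum1_count big_enum_cond big_mkcond /=.
(* The ends of larger rank are the images under [m] of those of smaller rank. *)
rewrite [X in _ = (_ + X)%N](reindex_inj (@perm_inj _ m)) /=.
rewrite [LHS](bigID (fun s => (enum_rank s < enum_rank (m s))%N)) /=.
congr (_ + _)%N.
apply: eq_big => s; last by rewrite mm; case: (P s).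
case/andP: (pm s) => ms _; rewrite mm -leqNgt leq_eqVlt.
by case: eqP => // /ord_inj/enum_rank_inj/eqP; rewrite (negbTE ms).
Qed.

Lemma edge_prod_pairing (R : realType) (x : curvature_data R) m
    (f : {ffun V -> 'I_3}) :
  edge_prod (link x) (pairing_edges m) f =
  \prod_(s | (enum_rank s < enum_rank (m s))%N) invmx (metric x) (f s) (f (m s)).
Proof.
rewrite /edge_prod big_map big_filter big_enum_cond; apply: eq_bigr => s _.
by rewrite /link /chain expr0 mulmx1.
Qed.

(** The default [s] concerns only vertices on no edge, which are absent when the edges cover [V]. *)
Fixpoint partner (T : Type) (L : seq (V * V * T)) (s : V) : V :=
  if L is e :: L' then
    if s == e.1.1 then e.1.2 else if s == e.1.2 then e.1.1 else partner L' s
  else s.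

Lemma partner_edge (T : eqType) (L : seq (V * V * T)) e : uniq (ends L) -> e \in L ->
  [/\ partner L e.1.1 = e.1.2, partner L e.1.2 = e.1.1 & e.1.1 != e.1.2].
Proof.
elim: L => // e' L IH; rewrite ends_cons /= !inE negb_or.
move=> /andP[/andP[ne n1] /andP[n2 uq]] /predU1P[->|eL].
  by rewrite !eqxx [e'.1.2 == _]eq_sym (negbTE ne).
have [p1 p2 n12] := IH uq eL.
have e1 : e.1.1 \in ends L.
  by apply/flattenP; exists [:: e.1.1; e.1.2]; rewrite ?inE ?eqxx // map_f.
have e2 : e.1.2 \in ends L.
  by apply/flattenP; exists [:: e.1.1; e.1.2]; rewrite ?inE ?eqxx ?orbT // map_f.
have neq z : z \in ends L -> (z == e'.1.1 = false) * (z == e'.1.2 = false).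
  move=> zL; split; first by apply: contraNF n1 => /eqP <-.
  by apply: contraNF n2 => /eqP <-.
by rewrite !neq.
Qed.

(** The involution is [partner L]. Its edge list may differ from [L] in order and orientation, which
    the symmetry of the inverse metric absorbs. *)
Lemma pairing_of_edges (L : seq (V * V * nat)) :
  perm_eq (enum V) (ends L) -> all (fun e => e.2 == 0%N) L ->
  exists2 m : {perm V}, is_pairing m &
    forall (R : realType) (x : curvature_data R) (f : {ffun V -> 'I_3}),
      edge_prod (link x) (pairing_edges m) f = edge_prod (link x) L f.
Proof.
move=> pL L0; have uq : uniq (ends L) by rewrite -(perm_uniq pL) enum_uniq.
have edgeP s : exists2 e, e \in L & (s = e.1.1) \/ (s = e.1.2).
  have : s \in ends L by rewrite -(perm_mem pL) mem_enum.
  case/flattenP => _ /mapP[e eL ->]; rewrite !inE => se; exists e => //.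
  by case/orP: se => /eqP; [left|right].
have pK : involutive (partner L).
  by move=> s; have [e eL [] ->] := edgeP s; have [p1 p2 _] := partner_edge uq eL;
     rewrite ?p1 ?p2 ?p1.
exists (perm (inv_inj pK)) => [|R x f].
  apply/forallP => s; rewrite !permE pK eqxx andbT.
  have [e eL [] ->] := edgeP s; have [p1 p2 n12] := partner_edge uq eL.
    by rewrite p1 eq_sym.
  by rewrite p2.
set m := perm _; rewrite edge_prod_pairing.
transitivity (\prod_(s <- enum V | (enum_rank s < enum_rank (m s))%N)
  invmx (metric x) (f s) (f (m s))); first by rewrite big_enum_cond.
rewrite (perm_big _ pL) /= /m.
rewrite /ends big_flatten big_map /edge_prod big_seq [RHS]big_seq.
apply: eq_bigr => e eL; have [p1 p2 n12] := partner_edge uq eL.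
have /eqP -> := allP L0 _ eL.
rewrite /link /chain expr0 mulmx1 !big_cons big_nil !permE p1 p2.
(* Exactly one end of an edge has the smaller rank, so each edge contributes a single factor. *)
case: ltngtP => [_|_|/ord_inj/enum_rank_inj/eqP].
- exact: mulr1.
- by rewrite inv_metric_sym; exact: mulr1.
- by rewrite (negbTE n12).
Qed.

End Pairings.

(** * Contractions as networks *)

Section SlotNetworks.

Variable I : finType.

(** The slots are parameters because they are 0 and 1 for a Ricci tensor, but 1 and 3 for a Riemann
    tensor whose slots 0 and 2 are contracted. *)
Definition ricci_sites (V : finType) (p q : I -> V) (s : seq I) : seq (V * V * bool) :=
  [seq (p i, q i, true) | i <- s].

Lemma weight_ricci_sites (V : finType) (p q : I -> V) s :
  (\sum_(e <- ricci_sites p q s) e.2 = size s)%N.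
Proof. by rewrite big_map /= big_const_seq count_predT iter_addn_0 mul1n. Qed.

Lemma weight_pairing_edges (V : finType) (m : {perm V}) :
  (\sum_(e <- pairing_edges m) e.2 = 0)%N.
Proof. by rewrite big_map /= big1. Qed.

Lemma ends_ricci_sites2 :
  perm_eq (ends (ricci_sites (fun i : I => (i, 0 : 'I_2)) (fun i => (i, 1 : 'I_2))
    (enum I))) (enum {: I * 'I_2}).
Proof.
rewrite /ends /ricci_sites -map_comp.
have -> : flatten [seq ((fun e : I * 'I_2 * (I * 'I_2) * bool => [:: e.1.1; e.1.2]) \o
   (fun i => (i, 0, (i, 1), true))) i | i <- enum I] =
   [seq (i, j) | i <- enum I, j <- [:: 0; 1 : 'I_2]] by [].
apply: uniq_perm; rewrite ?enum_uniq ?allpairs_uniq ?enum_uniq //.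
  by move=> [? ?] [? ?].
move=> [i j]; rewrite mem_enum inE; apply/allpairsP; exists (i, j).
rewrite mem_enum !inE; split=> //=.
by case: j => [[|[|//]]].
Qed.

Definition quads : seq ('I_4 -> I * 'I_4) := [seq (fun j => (i, j)) | i <- enum I].

Lemma ends4_quads : perm_eq (ends4 quads) (enum {: I * 'I_4}).
Proof.
rewrite /ends4 /quads -map_comp.
have -> : flatten [seq ((fun q : 'I_4 -> I * 'I_4 => [:: q 0; q 1; q 2; q 3]) \o
   (fun i j => (i, j))) i | i <- enum I] =
   [seq (i, j) | i <- enum I, j <- [:: 0; 1; 2; 3 : 'I_4]] by [].
apply: uniq_perm; rewrite ?enum_uniq ?allpairs_uniq ?enum_uniq //.
  by move=> [? ?] [? ?].
move=> [i j]; rewrite mem_enum inE; apply/allpairsP; exists (i, j).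
rewrite mem_enum !inE; split=> //=.
by case: j => [[|[|[|[|//]]]]].
Qed.

End SlotNetworks.

Section Contractions.

Variables (R : realType) (n : nat).

Lemma contraction_ricci (m : {perm 'I_n * 'I_2}) x :
  contraction (@ricci_tensor R) m x =
  network (ricci_sites (fun i => (i, 0)) (fun i => (i, 1)) (enum 'I_n))
    (pairing_edges m) x.
Proof.
apply: eq_bigr => f _; rewrite edge_prod_pairing /edge_prod big_map big_enum /=.
by congr (_ * _); apply: eq_bigr => i _; rewrite /site /= mxE.
Qed.

Lemma contraction_riemann (m : {perm 'I_n * 'I_4}) x :
  contraction (@riemann_tensor R) m x =
  riemann_network (quads 'I_n) [::] (pairing_edges m) x.
Proof.
apply: eq_bigr => f _; rewrite edge_prod_pairing /edge_prod big_nil mul1r.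
by rewrite big_map big_enum.
Qed.

Lemma homog_contraction_ricci m : m \in pairings n 2 ->
  homog n (contraction (@ricci_tensor R) m).
Proof.
rewrite inE => pm; have e := ends_ricci_sites2 'I_n.
have := @homog_network R _ _ (pairing_edges m) _ (perm_trans e (ends_pairing_edges pm)).
rewrite (perm_uniq e) enum_uniq weight_ricci_sites weight_pairing_edges.
rewrite size_enum_ord addn0 => /(_ isT); apply: homog_ext => x.
by rewrite contraction_ricci.
Qed.

Lemma homog_contraction_riemann m : m \in pairings n 4 ->
  homog n (contraction (@riemann_tensor R) m).
Proof.
rewrite inE => pm; have e := ends4_quads 'I_n.
have := @homog_riemann_network R _ (quads 'I_n) [::] (pairing_edges m).
rewrite cats0 (perm_uniq e) enum_uniq => /(_ isT).
move=> /(_ (perm_trans e (ends_pairing_edges pm))).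
rewrite big_nil weight_pairing_edges size_map size_enum_ord !addn0.
by apply: homog_ext => x; rewrite contraction_riemann.
Qed.

End Contractions.

(** * Realising monomials as contractions *)

Section Cycles.

Variables (R : realType) (I V : finType) (p q : I -> V).
Hypotheses (p_inj : injective p) (q_inj : injective q).
Hypothesis pq : forall i j, p i != q j.

(** An open path: the link closing it into a cycle, between [p a] and [q (last a s)], is added
    separately. *)
Fixpoint path_edges (a : I) (s : seq I) : seq (V * V * nat) :=
  if s is b :: s' then (q a, p b, 0%N) :: path_edges b s' else [::].

Lemma mem_ends_sites z s : z \in ends (ricci_sites p q s) ->
  exists2 i, i \in s & z = p i \/ z = q i.
Proof.
rewrite /ends /ricci_sites -map_comp => /flattenP[_ /mapP[i is_ ->]].
by rewrite !inE => /orP[]/eqP ->; exists i; rewrite ?is_; auto.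
Qed.

Lemma mem_ends_path z a s : z \in ends (path_edges a s) ->
  exists2 i, i \in a :: s & z = p i \/ z = q i.
Proof.
elim: s a => // b s IH a; rewrite ends_cons /= !inE => /or3P[/eqP->|/eqP->|].
- by exists a; rewrite ?mem_head; auto.
- by exists b; rewrite ?inE ?eqxx ?orbT; auto.
- by move/IH => [i ibs zi]; exists i; rewrite // in_cons ibs orbT.
Qed.

Lemma ends_sites_cons a s :
  ends (ricci_sites p q (a :: s)) = [:: p a, q a & ends (ricci_sites p q s)].
Proof. by []. Qed.

Lemma ends_path a s :
  perm_eq (ends (ricci_sites p q (a :: s)))
    [:: p a, q (last a s) & ends (path_edges a s)].
Proof.
elim: s a => [|b s IH] a //; rewrite ends_sites_cons [path_edges _ _]/= ends_cons.
rewrite perm_cons; apply: (@perm_trans _ [:: q a, p b, q (last b s) & ends (path_edges b s)]).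
  by rewrite perm_cons; exact: IH.
by rewrite ends_cons; apply/seq.permP => P /=; lia.
Qed.

Lemma fresh_slot i z (l : seq I) : i \notin l -> (exists2 j, j \in l & z = p j \/ z = q j) ->
  (z != p i) && (z != q i).
Proof.
move=> il [j jl]; have ji : j != i by apply: contraNneq il => <-.
by case=> ->; rewrite ?pq ?(inj_eq p_inj) ?(inj_eq q_inj) 1?[q j == _]eq_sym ?pq ji.
Qed.

(** The weight [k] of the closing link is general because each merge absorbs a Ricci site into that
    link; the last site closes the loop. *)
Lemma network_cycle k a s s' L x :
  uniq (a :: s ++ s') -> {subset ends L <= ends (ricci_sites p q s')} ->
  network (ricci_sites p q (a :: s ++ s'))
    ((p a, q (last a s), k) :: path_edges a s ++ L) x *+ (9 ^ (size s).+1) =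
  trace_pow (k + (size s).+1) x * network (R := R) (ricci_sites p q s') L x.
Proof.
elim: s a k => [|b s IH] a k.
  rewrite /= expn1 => /andP[as' _] sub; rewrite network_loop //.
  have h z : z \in ends (ricci_sites p q s') ++ ends L -> (z != p a) && (z != q a).
    rewrite mem_cat => zs; apply: (fresh_slot as'); apply: mem_ends_sites.
    by case/orP: zs => // /sub.
  by rewrite /= andbT; apply/andP; split; apply/negP => /h; rewrite eqxx ?andbF.
move=> /andP[asb uq] sub.
have bs : b \in [:: b & s ++ s'] by rewrite mem_head.
have h z : z \in ends (ricci_sites p q (b :: s ++ s')) ++ ends (path_edges b s ++ L) ->
    (z != p a) && (z != q a).
  rewrite mem_cat (ends_cat (path_edges b s)) => zs; apply: (fresh_slot asb).
  case/orP: zs => [/mem_ends_sites // | ]; rewrite mem_cat.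
  case/orP=> [/mem_ends_path[i ib zi] | /sub/mem_ends_sites[i ib zi]].
    by exists i; rewrite // mem_cat ib.
  by exists i; rewrite // mem_cat ib orbT.
have la : last b s \in [:: b & s ++ s'] by rewrite -cat_cons mem_cat mem_last.
rewrite expnS mulrnA [path_edges _ _]/= [last _ _]/= [ricci_sites _ _ _]/=.
rewrite cat_cons network_merge; last 2 first.
- have /andP[pp qp] : (p b != p a) && (p b != q a).
    by apply: (fresh_slot asb); exists b; auto.
  have /andP[pl ql] : (q (last b s) != p a) && (q (last b s) != q a).
    by apply: (fresh_slot asb); exists (last b s); auto.
  rewrite /= !inE !negb_or pq !(eq_sym (p a)) !(eq_sym (q a)) pp qp pl ql.
  by rewrite eq_sym pq.
- by rewrite /= andbT; apply/andP; split; apply/negP => /h; rewrite eqxx ?andbF.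
(* The merged link runs from [q (last b s)] to [p b], opposite to the closing link in the induction
   hypothesis; link symmetry reconciles them. *)
have := IH b (k + true + 0)%N uq sub.
rewrite addn0 addn1 addSnnS => <-; congr (_ *+ _); apply: network_eqr => f.
by rewrite !edge_prod_cons /= link_sym.
Qed.

(* [L] wires consecutive blocks of [s], of sizes [b.+1] for b in [bs], into cycles. *)
Lemma cycle_wiring bs s : uniq s -> size s = sumn [seq b.+1 | b <- bs] ->
  exists2 L : seq (V * V * nat),
    perm_eq (ends (ricci_sites p q s)) (ends L) /\ all (fun e => e.2 == 0%N) L &
    forall x, network (ricci_sites p q s) L x *+ (9 ^ size s) =
      (\prod_(b <- bs) trace_pow b.+1 x) * (3 ^+ #|V| : R).
Proof.
elim: bs s => [|b bs IH] s.
  move=> _ /size0nil ->; exists [::] => // x.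
  rewrite expn0 mulr1n big_nil mul1r /network.
  under eq_bigr do rewrite /edge_prod !big_nil mulr1.
  by rewrite sumr_const card_ffun card_ord -natrX.
case: s => // a s uq /= [ss].
pose s1 := take b s; pose s2 := drop b s.
have s12 : s = s1 ++ s2 by rewrite cat_take_drop.
have sz1 : size s1 = b by rewrite size_take_min ss; apply/minn_idPl; lia.
have sz2 : size s2 = sumn [seq b.+1 | b <- bs] by rewrite size_drop ss addKn.
have uq2 : uniq s2 by move: uq; rewrite s12 /= cat_uniq => /and4P[].
have [L [pL L0] eL] := IH s2 uq2 sz2.
exists ((p a, q (last a s1), 0%N) :: path_edges a s1 ++ L); first split.
- rewrite s12 -cat_cons /ricci_sites map_cat ends_cat ends_cons ends_cat /=.
  rewrite -!cat_cons; apply: perm_cat => //; exact: ends_path.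
- rewrite /= all_cat L0 andbT; by elim: {+}s1 {+}a => /=.
move=> x; rewrite big_cons -mulrA -eL mulrnAr -sz1 -[X in trace_pow X]add0n.
rewrite -(@network_cycle _ a _ s2); last first.
- by move=> z; rewrite (perm_mem pL).
- by rewrite -s12.
by rewrite -s12 -mulrnA -expnD addSn -size_cat -s12.
Qed.

End Cycles.

Section Realize.

Variables (R : realType).

(** Wiring the tensors into cycles gives the product of traces. A cycle of length [b.+1] is encoded
    by [b], which excludes empty cycles. *)
Lemma realize_ricci n bs : n = sumn [seq b.+1 | b <- bs] ->
  exists2 m, m \in pairings n 2 & exists2 c : R, c != 0 &
    forall x, contraction (@ricci_tensor R) m x =
      c * \prod_(b <- bs) trace_pow b.+1 x.
Proof.
move=> nbs; pose p (i : 'I_n) := (i, 0 : 'I_2); pose q (i : 'I_n) := (i, 1 : 'I_2).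
have p_inj : injective p by move=> i j [].
have q_inj : injective q by move=> i j [].
have pq i j : p i != q j by rewrite xpair_eqE andbF.
have [|L [pL L0] eL] := cycle_wiring R p_inj q_inj pq (enum_uniq 'I_n) (bs := bs).
  by rewrite size_enum_ord.
have eV := ends_ricci_sites2 'I_n; rewrite perm_sym in eV.
have [m pm em] := pairing_of_edges (perm_trans eV pL) L0.
exists m; first by rewrite inE.
(* With two slots per tensor this constant equals 1, but only its being nonzero matters. *)
exists ((9 ^ n)%:R^-1 * 3 ^+ #|{: 'I_n * 'I_2}|).
  by rewrite mulf_neq0 ?invr_neq0 ?expf_neq0 // pnatr_eq0 // expn_eq0.
move=> x; rewrite contraction_ricci (network_eqr _ (em R x)) mulrAC -mulrA -eL.
by rewrite size_enum_ord -(mulr_natl (network _ _ _)) mulKf // pnatr_eq0 expn_eq0.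
Qed.

Section Riemann.

Variable I : finType.

(** By definition of [ricci], summing over slots 0 and 2 leaves a Ricci site on slots 1 and 3, with
    a factor 9 each time. [L1] is general because it collects the sites already formed. *)
Lemma riemann_network_trace s (L1 : seq (I * 'I_4 * (I * 'I_4) * bool))
    (L2 : seq (I * 'I_4 * (I * 'I_4) * nat)) (x : curvature_data R) :
  uniq s -> (forall z, z \in ends L1 ++ ends L2 -> (z.2 != 0) && (z.2 != 2)) ->
  riemann_network [seq (fun j => (i, j)) | i <- s] L1
    ([seq ((i, 0), (i, 2), 0%N) | i <- s] ++ L2) x *+ (9 ^ size s) =
  network (ricci_sites (fun i => (i, 1)) (fun i => (i, 3)) s ++ L1) L2 x.
Proof.
elim: s L1 => [|a s IH] L1.
  by move=> _ _; apply: eq_bigr => f _; rewrite big_nil mul1r.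
rewrite cons_uniq => /andP[as_ uq] fresh.
pose L2' := [seq ((i, 0 : 'I_4), (i, 2 : 'I_4), 0%N) | i <- s] ++ L2.
pose L1' := ((a, 1 : 'I_4), (a, 3 : 'I_4), true) :: L1.
have -> : network (ricci_sites (fun i => (i, 1)) (fun i => (i, 3)) (a :: s) ++ L1) L2 x =
    network (ricci_sites (fun i => (i, 1)) (fun i => (i, 3)) s ++ L1') L2 x.
  apply: eq_bigr => f _; congr (_ * _).
  by rewrite /= edge_prod_cons !edge_prod_cat edge_prod_cons mulrCA.
rewrite -(IH L1') //; last first.
  move=> z; rewrite ends_cons mem_cat !inE -!orbA => /or3P[/eqP->|/eqP->|zL] //.
  by apply: fresh; rewrite mem_cat.
rewrite expnS mulrnA; congr (_ *+ _).
have nL1 j : (j == 0) || (j == 2) -> (a, j) \notin ends L1.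
  move=> j02; apply/negP => aL; have := fresh (a, j).
  by rewrite mem_cat aL => /(_ isT) /=; case/orP: j02 => /eqP ->.
have nL2 j : (j == 0) || (j == 2) -> (a, j) \notin ends L2'.
  move=> j02; rewrite ends_cat mem_cat negb_or; apply/andP; split.
    apply/negP => /flattenP[_ /mapP[_ /mapP[i is_ ->] ->]] /=.
    by rewrite !inE !xpair_eqE => /orP[]/andP[/eqP ai]; rewrite ai is_ in as_.
  apply/negP => aL; have := fresh (a, j).
  by rewrite mem_cat aL orbT => /(_ isT) /=; case/orP: j02 => /eqP ->.
pose Ps (f : {ffun I * 'I_4 -> 'I_3}) :=
  \prod_(i <- s) riemann_tensor x (fun j => f (i, j)).
have indP j f b : Ps (upd f (a, j) b) = Ps f.
  rewrite /Ps big_seq [RHS]big_seq; apply: eq_bigr => i is_.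
  have ia k : (i, k) != (a, j).
    by rewrite xpair_eqE; apply: contraNN as_ => /andP[/eqP <-].
  by rewrite /riemann_tensor !upd_other.
rewrite /riemann_network.
have -> : (9 = #|'I_3| * #|'I_3|)%N by rewrite card_ord.
rewrite (sum_upd2 (a, 0) (a, 2)); apply: eq_bigr => f _.
transitivity (ricci x (f (a, 1)) (f (a, 3)) *
   (Ps f * (edge_prod (site x) L1 f * edge_prod (link x) L2' f))).
  rewrite mulr_suml; apply: eq_bigr => b _.
  rewrite mulr_suml; apply: eq_bigr => c _.
  rewrite !big_cons edge_prod_cons -/L2'.
  rewrite big_map -[\prod_(j <- s) _]/(Ps _) !indP !indep_edge_prod ?nL1 ?nL2 //.
  rewrite /riemann_tensor !(upd_same, upd_other) ?xpair_eqE ?andbF //.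
  by rewrite /link /chain expr0 mulmx1; ring.
rewrite big_map -/(Ps f) edge_prod_cons /site /= mxE.
by rewrite -/(site x); ring.
Qed.

End Riemann.

Lemma realize_riemann n bs : n = sumn [seq b.+1 | b <- bs] ->
  exists2 m, m \in pairings n 4 & exists2 c : R, c != 0 &
    forall x, contraction (@riemann_tensor R) m x =
      c * \prod_(b <- bs) trace_pow b.+1 x.
Proof.
move=> nbs; pose p (i : 'I_n) := (i, 1 : 'I_4); pose q (i : 'I_n) := (i, 3 : 'I_4).
have p_inj : injective p by move=> i j [].
have q_inj : injective q by move=> i j [].
have pq i j : p i != q j by rewrite xpair_eqE andbF.
have [|L [pL L0] eL] := cycle_wiring R p_inj q_inj pq (enum_uniq 'I_n) (bs := bs).
  by rewrite size_enum_ord.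
(* The added links contract each Riemann tensor to a Ricci tensor, and [L] wires the remaining
   slots. *)
pose L' := [seq ((i, 0 : 'I_4), (i, 2 : 'I_4), 0%N) | i <- enum 'I_n] ++ L.
have eV : perm_eq (enum {: 'I_n * 'I_4}) (ends L').
  have e4 := ends4_quads 'I_n; rewrite perm_sym in e4.
  apply: perm_trans e4 _; rewrite /L' ends_cat perm_sym.
  set e02 := ends [seq _ | i <- enum 'I_n].
  apply: (@perm_trans _ (e02 ++ ends (ricci_sites p q (enum 'I_n)))).
    by rewrite perm_cat2l perm_sym; exact: pL.
  rewrite {}/e02.
  rewrite /ends4 /quads /ends /ricci_sites; elim: (enum 'I_n) => // i s IHs.
  rewrite /= -!map_comp in IHs *.
  apply/seq.permP => P; have /seq.permP/(_ P) := IHs.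
  rewrite /= !count_cat /p /q /= => <-; move: (count _ _) (count _ _) => c1 c2.
  by move: (P (i, 0)) (P (i, 1)) (P (i, 2)) (P (i, 3)) => b0 b1 b2 b3; lia.
have L'0 : all (fun e => e.2 == 0%N) L'.
  by rewrite all_cat L0 andbT; apply/allP => _ /mapP[i _ ->].
have [m pm em] := pairing_of_edges eV L'0.
exists m; first by rewrite inE.
(* One power of 9 comes from forming the Ricci tensors, the other from closing the cycles. *)
exists ((9 ^ n)%:R^-1 * (9 ^ n)%:R^-1 * 3 ^+ #|{: 'I_n * 'I_4}|).
  by rewrite !mulf_neq0 ?invr_neq0 ?expf_neq0 // pnatr_eq0 // expn_eq0.
have n9 : (9 ^ n)%:R != 0 :> R by rewrite pnatr_eq0 expn_eq0.
move=> x; rewrite contraction_riemann.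
transitivity (riemann_network (quads 'I_n) [::] L' x).
  by apply: eq_bigr => f _; rewrite em.
rewrite -!mulrA [3 ^+ _ * _]mulrC -eL.
rewrite -[ricci_sites _ _ _]cats0 -riemann_network_trace ?enum_uniq //.
  by rewrite size_enum_ord -(mulr_natl (_ *+ _)) -(mulr_natl (riemann_network _ _ _ _)) !mulKf.
move=> z; rewrite mem_cat -(perm_mem pL) orFb => /mem_ends_sites[i _ [] ->] //.
Qed.

End Realize.

(** * Linear independence and counting *)

(** A polynomial vanishing at all natural numbers is zero. Exponents may repeat, so the lemma can be
    applied one variable at a time. *)
Lemma sum_pow_eq0 (R : numDomainType) (I : finType) (c : I -> R) (e : I -> nat) :
  (forall x, \sum_i c i * x ^+ e i = 0) ->
  forall k, \sum_(i | e i == k) c i = 0.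
Proof.
move=> c0 k; pose p : {poly R} := \sum_i c i *: 'X^(e i).
have p0 : p = 0.
  apply: (@roots_geq_poly_eq0 _ _ [seq i%:R | i <- iota 0 (size p)]).
  - apply/allP => _ /mapP[i _ ->]; rewrite rootE horner_sum -[X in _ == X](c0 i%:R).
    by apply/eqP/eq_bigr => j _; rewrite hornerZ hornerXn.
  - by rewrite map_inj_uniq ?iota_uniq // => i j /eqP; rewrite eqr_nat => /eqP.
  - by rewrite size_map size_iota.
transitivity p`_k; last by rewrite p0 coef0.
rewrite coef_sum [RHS](bigID (fun i => e i == k)) /= [X in _ = _ + X]big1 ?addr0.
  by apply: eq_bigr => i /eqP <-; rewrite coefZ coefXn eqxx mulr1.
by move=> i ik; rewrite coefZ coefXn eq_sym (negbTE ik) mulr0.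
Qed.

(** * Maximal independent subfamilies *)

Section MaxIndep.

Variables (R : realType) (X : Type) (I J : finType).
Variables (F : I -> X -> R) (G : J -> X -> R) (P : {set I}).
Hypothesis G_indep : lin_indep G [set: J].
Hypothesis F_span : forall i, i \in P ->
  exists c : J -> R, forall x, F i x = \sum_j c j * G j x.
Hypothesis F_hits : forall j,
  exists2 i, i \in P & exists2 c : R, c != 0 & forall x, F i x = c * G j x.

Lemma family_coef_eq0 (c : J -> R) : (forall x, \sum_j c j * G j x = 0) -> forall j, c j = 0.
Proof.
move=> c0 j; apply: (G_indep _ (in_setT j)) => x; rewrite -[RHS](c0 x).
by apply: eq_bigl => i; rewrite inE.
Qed.

(** The coordinates of [A] with respect to [G] form a matrix with independent rows, which has at
    most as many rows as columns. *)
Lemma lin_indep_card_le (A : {set I}) : A \subset P -> lin_indep F A -> (#|A| <= #|J|)%N.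
Proof.
move=> /subsetP AP FA.
have [C CE] : exists C : I -> J -> R,
    forall i, i \in P -> forall x, F i x = \sum_j C i j * G j x.
  apply: (@fin_all_exists I (fun=> J -> R)
    (fun i c => i \in P -> forall x, F i x = \sum_j c j * G j x)) => i.
  case: (boolP (i \in P)) => [/F_span[c cE]|_].
    by exists c.
  by exists (fun=> 0).
pose M : 'M[R]_(#|A|, #|J|) := \matrix_(a, j) C (enum_val a) (enum_val j).
suff : row_free M by move=> /eqP <-; exact: rank_leq_col.
apply: inj_row_free => v vM.
(* The sum has at most one term and extends [v] by zero outside [A]. *)
pose c i := \sum_(a | enum_val a == i) v 0 a.
have cE a : c (enum_val a) = v 0 a.
  by rewrite /c (big_pred1 a) // => b; rewrite /= (inj_eq enum_val_inj).
apply/rowP => a; rewrite mxE -cE; apply: (FA c); last exact: enum_valP.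
move=> x; rewrite big_enum_val /=.
under eq_bigr => b _ do rewrite cE (CE _ (AP _ (enum_valP b))) mulr_sumr.
rewrite exchange_big big1 //= => j _.
have /rowP/(_ (enum_rank j)) := vM; rewrite !mxE => vj.
under eq_bigr do rewrite mulrA.
rewrite -mulr_suml [X in X * _](_ : _ = 0) ?mul0r // -[RHS]vj.
by apply: eq_bigr => b _; rewrite mxE enum_rankK.
Qed.

Lemma max_indep_eq : max_indep F P = #|J|.
Proof.
apply/eqP; rewrite eqn_leq; apply/andP; split.
  by apply/bigmax_leqP => A /andP[AP /asboolP]; exact: lin_indep_card_le.
have [h hP] : exists h : J -> I, forall j, h j \in P /\
    exists2 c : R, c != 0 & forall x, F (h j) x = c * G j x.
  apply: (@fin_all_exists J (fun=> I) (fun j i => i \in P /\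
    exists2 c : R, c != 0 & forall x, F i x = c * G j x)) => j.
  by have [i iP ci] := F_hits j; exists i.
have [d dP] : exists d : J -> R, forall j, d j != 0 /\ forall x, F (h j) x = d j * G j x.
  apply: (@fin_all_exists J (fun=> R) (fun j c => c != 0 /\
    forall x, F (h j) x = c * G j x)) => j.
  by have [_ [c c0 cE]] := hP j; exists c.
have h_inj : injective h.
  move=> j k hjk; apply/eqP/contraT => jk.
  (* If [h j = h k], the two multiples of [G j] and [G k] coincide, which is a nontrivial
     relation. *)
  pose c i := if i == j then d j else if i == k then - d k else 0.
  have := @family_coef_eq0 c _ j; rewrite /c eqxx => cj.
  have [dj _] := dP j; rewrite cj ?eqxx // in dj => x.
  have kj : (k == j) = false by rewrite eq_sym (negbTE jk).
  rewrite (bigD1 j) //= eqxx (bigD1 k) /= ?kj // eqxx.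
  rewrite big1 => [|i /andP[/negbTE -> /negbTE ->]]; last by rewrite mul0r.
  have [_ <-] := dP j; have [_ dk] := dP k.
  by rewrite mulNr -dk hjk addr0 subrr.
rewrite -(card_imset _ h_inj).
apply: (@leq_bigmax_cond _ _ (fun A : {set I} => #|A|)).
apply/andP; split.
  by apply/subsetP => _ /imsetP[j _ ->]; have [] := hP j.
apply/asboolP => c c0 _ /imsetP[j _ ->].
have : c (h j) * d j = 0.
  apply: (@family_coef_eq0 (fun j => c (h j) * d j)) => x; rewrite -[RHS](c0 x).
  rewrite big_imset /=; last by move=> ? ? _ _; exact: h_inj.
  by apply: eq_bigr => k _; have [_ ->] := dP k; rewrite mulrA.
by move/eqP; rewrite mulf_eq0 (negbTE (dP j).1) orbF => /eqP.
Qed.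

End MaxIndep.

(** * The monomial basis *)

Section Monomials.

Variables (R : realType) (n : nat).

(** Exponents of t_2 and t_3 only, as the order [n] fixes that of t_1; the bound [n.+1] follows from
    the inequality and makes the type finite. *)
Definition mon_index : finType :=
  {p : 'I_n.+1 * 'I_n.+1 | (2 * p.1 + 3 * p.2 <= n)%N}.

Definition mon_exp (p : mon_index) : nat * nat := ((val p).1 : nat, (val p).2 : nat).

Lemma mon_exp_inj : injective mon_exp.
Proof.
move=> [[i j] p] [[i' j'] p'] [/= /ord_inj ii /ord_inj jj].
by apply: val_inj; rewrite /= ii jj.
Qed.

Lemma mon_expP q : (2 * q.1 + 3 * q.2 <= n)%N -> exists p, mon_exp p = q.
Proof.
case: q => j k /= jk.
have jn : (j < n.+1)%N by lia.
have kn : (k < n.+1)%N by lia.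
by exists (exist _ (Ordinal jn, Ordinal kn) jk).
Qed.

Definition mon (p : mon_index) : curvature_data R -> R := trace_mon n (mon_exp p).

Lemma mon_indep : lin_indep mon [set: mon_index].
Proof.
move=> c c0 p _.
(* Setting t_1 = 1 loses nothing, since its exponent is determined by the others. Coefficients are
   then compared in [z], and next in [y]. *)
have c0' y z : \sum_i c i * y ^+ (mon_exp i).1 * z ^+ (mon_exp i).2 = 0.
  have [x [x1 x2 x3]] := trace_pow_surj (1 : R) y z.
  rewrite -[RHS](c0 x); apply: eq_big => i; first by rewrite inE.
  by rewrite /mon /trace_mon x1 x2 x3 expr1n mul1r mulrA.
have := fun y => sum_pow_eq0 (c0' y) (mon_exp p).2.
move=> c0''.
have {}c0'' y : \sum_i (if (mon_exp i).2 == (mon_exp p).2 then c i else 0) *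
    y ^+ (mon_exp i).1 = 0.
  by rewrite -[RHS](c0'' y) [RHS]big_mkcond; apply: eq_bigr => i _; case: ifP; rewrite ?mul0r.
have := sum_pow_eq0 c0'' (mon_exp p).1; rewrite -big_mkcondr /=.
by rewrite (big_pred1 p).
Qed.

Lemma homog_span (F : curvature_data R -> R) : homog n F ->
  exists c : mon_index -> R, forall x, F x = \sum_p c p * mon p x.
Proof.
move=> [s [sn sF]]; exists (fun p => \sum_(q <- s | q.2 == mon_exp p) q.1) => x.
rewrite sF; under [RHS]eq_bigr do rewrite mulr_suml big_mkcond.
rewrite exchange_big big_seq [RHS]big_seq; apply: eq_bigr => q qs /=.
have [p pq] := mon_expP (allP sn _ qs).
rewrite -big_mkcond (big_pred1 p) => [|i /=]; first by rewrite /mon pq.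
by rewrite -pq (inj_eq mon_exp_inj) eq_sym.
Qed.

Lemma mon_cycles (p : mon_index) : exists2 bs, n = sumn [seq b.+1 | b <- bs] &
  forall x, \prod_(b <- bs) trace_pow b.+1 x = mon p x.
Proof.
have /= := valP p; set j := nat_of_ord _; set k := nat_of_ord _ => jk.
(* The entries 0, 1, 2 encode cycles of lengths 1, 2, 3. *)
exists (nseq (n - (2 * j + 3 * k)) 0 ++ nseq j 1 ++ nseq k 2)%N.
  by rewrite !map_cat !map_nseq !sumn_cat !sumn_nseq; lia.
by move=> x; rewrite !big_cat !big_nseq /= !iter_mulr !mulr1 mulrA.
Qed.

Lemma num_ricci_densitiesE : num_ricci_densities R n = #|mon_index|.
Proof.
apply: (max_indep_eq mon_indep) => [m mP|p].
  exact/homog_span/homog_contraction_ricci.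
have [bs nbs bsE] := mon_cycles p; have [m mP [c c0 cE]] := realize_ricci R nbs.
by exists m => //; exists c => // x; rewrite cE bsE.
Qed.

Lemma num_riemann_densitiesE : num_riemann_densities R n = #|mon_index|.
Proof.
apply: (max_indep_eq mon_indep) => [m mP|p].
  exact/homog_span/homog_contraction_riemann.
have [bs nbs bsE] := mon_cycles p; have [m mP [c c0 cE]] := realize_riemann R nbs.
by exists m => //; exists c => // x; rewrite cE bsE.
Qed.

End Monomials.

(** * Counting the monomials *)

Lemma sum_ord_trim (m M : nat) (F : nat -> nat) : (m <= M)%N ->
  (forall i, m <= i -> F i = 0)%N -> (\sum_(i < M) F i = \sum_(i < m) F i)%N.
Proof.
move=> mM F0; rewrite -(subnKC mM) big_split_ord /= [X in (_ + X)%N]big1 ?addn0 //.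
by move=> i _; rewrite F0 // leq_addr.
Qed.

Lemma sum_double_leq M n : (n < M)%N -> (\sum_(j < M) (2 * j <= n) = n./2.+1)%N.
Proof.
move=> nM; rewrite (@sum_ord_trim n./2.+1 _ (fun j => (2 * j <= n)%N : nat)).
- rewrite -[RHS]card_ord -sum1_card; apply: eq_bigr => -[j jn] _ /=.
  by rewrite (_ : (2 * j <= n)%N) //; lia.
- by lia.
- by move=> i ni; apply/eqP; rewrite eqb0; lia.
Qed.

(** A free bound [M] lets the counts for [n] and [n + 3] range over the same box. *)
Lemma card_mon_indexE n M : (n < M)%N ->
  #|mon_index n| = (\sum_(k < M) \sum_(j < M) (2 * j + 3 * k <= n))%N.
Proof.
move=> nM; pose F k j : nat := (2 * j + 3 * k <= n)%N.
have F0 k j : (n < k)%N || (n < j)%N -> F k j = 0%N.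
  by move=> nkj; apply/eqP; rewrite eqb0; lia.
transitivity (\sum_(k < n.+1) \sum_(j < n.+1) F k j)%N; last first.
  rewrite (@sum_ord_trim n.+1 M (fun k => \sum_(j < M) F k j)%N) //.
    apply: eq_bigr => k _; rewrite (sum_ord_trim nM) // => j nj.
    by rewrite F0 // nj orbT.
  by move=> k nk; rewrite big1 // => j _; rewrite F0 // nk.
rewrite card_sig -sum1_card exchange_big pair_big /= big_mkcond /=.
by apply: eq_bigr => -[j k] _; rewrite unfold_in /= /F; case: ifP.
Qed.

(** The row [k = 0] contributes the new term; the rows with [k > 0] are those for [n], shifted by
    one. *)
Lemma card_mon_index3 n : #|mon_index (n + 3)| = (#|mon_index n| + (n + 3)./2.+1)%N.
Proof.
rewrite (@card_mon_indexE _ (n + 4)); last by lia.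
rewrite (@card_mon_indexE n (n + 4)); last by lia.
rewrite [RHS]addnC !addn3 !addn4 big_ord_recl; congr (_ + _)%N.
  rewrite -(@sum_double_leq n.+4) //.
  by apply: eq_bigr => j _; rewrite /= muln0 addn0.
(* The shift leaves one more row on the right, [k = n + 3], which is empty. *)
rewrite [RHS]big_ord_recr /= [X in (_ + X)%N]big1 ?addn0; last first.
  by move=> j _; apply/eqP; rewrite eqb0; lia.
apply: eq_bigr => k _; apply: eq_bigr => j _; congr nat_of_bool.
by rewrite /bump /=; lia.
Qed.

Lemma card_mon_index_lt6 n : (n < 6)%N -> #|mon_index n| = maxn 1 n.
Proof.
have small i : (i < 3)%N -> #|mon_index i| = maxn 1 i.
  by move: i => [|[|[|//]]] _; rewrite (card_mon_indexE (leqnn _)) !big_ord_recl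
    !big_ord0.
case: (ltnP n 3) => [/small //|n3 n6].
rewrite -(subnK n3) card_mon_index3 small; last by lia.
by rewrite /maxn; case: ifP; case: ifP; lia.
Qed.

(** Two steps of 3 add the halves of [n + 3] and [n + 6]; these have opposite parity, so the
    roundings combine to the same value for all [n]. *)
Lemma card_mon_index6 n : #|mon_index (n + 6)| = (#|mon_index n| + n + 6)%N.
Proof. by rewrite (addnA n 3 3) !card_mon_index3; lia. Qed.

Lemma ind6 (P : nat -> Prop) : (forall n, n < 6 -> P n)%N ->
  (forall n, P n -> P (n + 6)%N) -> forall n, P n.
Proof.
move=> P0 PS n; rewrite (divn_eq n 6); elim: (n %/ 6)%N => [|q IH].
  by apply: P0; rewrite mul0n ltn_mod.
by rewrite mulSnr addnAC; exact: PS.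
Qed.

(** Integer form of the ceiling formula. A step of 6 adds [12 * (n + 6)] to every member. *)
Lemma card_mon_index_bounds n :
  (n * n + 6 * n < 12 * #|mon_index n| <= n * n + 6 * n + 12)%N.
Proof.
elim/ind6: n => [n n6|n IH]; last by rewrite card_mon_index6; nia.
by rewrite card_mon_index_lt6 //; move: n n6; do 6![case=> //].
Qed.

(** * Closed formulas *)

Section Formulas.

Variable R : realType.

(** The triple angle formula gives $(c - 1)(2c + 1)^2 = 0$, and c = 1 is excluded by injectivity of
    the cosine on [0, pi]. *)
Lemma cos_2pi_thirds : cos (2 * pi / 3) = - 2^-1 :> R.
Proof.
set a := 2 * pi / 3; set c := cos a.
have c3 : cos (a *+ 2 + a) = 1.
  by rewrite (_ : _ + a = pi *+ 2) ?cos2pi // /a; field.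
have c1 : c != 1.
  rewrite -cos0; apply/eqP => /cos_inj; rewrite !in_itv /= lexx pi_ge0.
  have := pi_gt0 R => pi0.
  have a0 : 0 < a by rewrite /a; lra.
  have api : a <= pi by rewrite /a; lra.
  by rewrite (ltW a0) api => /(_ isT isT) a00; rewrite a00 ltxx in a0.
move: c3; rewrite cosD cos_mulr2n sin_mulr2n -/c.
rewrite mulrC mulrnAl -mulrA -expr2 sin2cos2 -/c => c3.
have : (c - 1) * (2 * c + 1) ^+ 2 = 0.
  apply: (etrans (_ : _ = (c * (c ^+ 2 *+ 2 - 1) - (c * (1 - c ^+ 2)) *+ 2) - 1)).
    by ring.
  by rewrite c3 subrr.
move/eqP; rewrite mulf_eq0 subr_eq0 (negbTE c1) expf_eq0 /= => /eqP c2.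
by lra.
Qed.

(** Both oscillating terms are unchanged by a step of 6, while the quadratic part grows by
    [n + 6]. *)
Lemma card_mon_index_cos n : #|mon_index n|%:R =
  72^-1 * (47 + 9 * (-1) ^+ n + 6 * n%:R * (6 + n%:R)
           + 16 * cos (2 * pi * n%:R / 3)) :> R.
Proof.
have per m : cos (2 * pi * (m + 3)%:R / 3 : R) = cos (2 * pi * m%:R / 3).
  by rewrite -[RHS]cosD2pi natrD; congr cos; field.
elim/ind6: n => [n n6|n IH].
  rewrite card_mon_index_lt6 //.
  have cs : [/\ cos (2 * pi * 0%:R / 3) = 1 :> R,
      cos (2 * pi * 1%:R / 3) = - 2^-1 :> R & cos (2 * pi * 2%:R / 3) = - 2^-1 :> R].
    split; rewrite ?mulr0 ?mul0r ?cos0 ?mulr1 ?cos_2pi_thirds //.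
    rewrite (_ : _ / 3 = (2 * pi / 3) *+ 2); last by field.
    by rewrite cos_mulr2n cos_2pi_thirds; field.
  have [c0 c1 c2] := cs.
  have := (per 0%N, per 1%N, per 2%N); rewrite !add0n !addSn !add0n c0 c1 c2 => c345.
  case: n n6 => [|[|[|[|[|[|//]]]]]] _;
    by rewrite ?(c0, c1, c2, c345) ?(exprS, expr0) /maxn /=; lra.
rewrite [in cos _](addnA n 3 3) !per card_mon_index6 !natrD IH exprD.
by rewrite (_ : (-1) ^+ 6 = 1 :> R) ?mulr1; [field | ring].
Qed.

(** The argument without [eps] is $(n^2 + 6n)/12$. The strict lower bound, being between integers,
    leaves room 1/12 for [eps]. *)
Lemma card_mon_index_ceil n (eps : R) : 0 < eps -> eps < 12^-1 ->
  #|mon_index n|%:Z = Num.ceil (n%:R / 2 * (n%:R / 6 + 1) + eps).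
Proof.
move=> e0 e1; apply/esym/ceil_def.
have /andP[] := card_mon_index_bounds n; set N := #|_|.
rewrite -!(ler_nat R) -natr1 !natrD !natrM => lo hi.
rewrite rmorphB /= -!pmulrn; apply/andP; split; lra.
Qed.

End Formulas.

Theorem mainTheorem9 (R : realType) :
  [/\ forall n : nat, num_ricci_densities R n = num_riemann_densities R n,
      forall n : nat, (1 <= n)%N ->
        (num_riemann_densities R n)%:R =
          72^-1 * (47 + 9 * (-1) ^+ n + 6 * n%:R * (6 + n%:R)
                   + 16 * cos (2 * pi * n%:R / 3)) :> R,
      exists2 eps0 : R, 0 < eps0 &
        forall eps : R, 0 < eps -> eps < eps0 ->
        forall n : nat, (1 <= n)%N ->
          (num_riemann_densities R n)%:Z =
            Num.ceil (n%:R / 2 * (n%:R / 6 + 1) + eps),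
      num_riemann_densities R 0 = 1%N
    & forall n : nat, (6 <= n)%N ->
        (num_riemann_densities R (n - 6))%:Z =
          (num_riemann_densities R n)%:Z - n%:Z].
Proof.
split=> [n|n _| | |n n6].
- by rewrite num_ricci_densitiesE num_riemann_densitiesE.
- by rewrite num_riemann_densitiesE card_mon_index_cos.
- exists 12^-1 => [|eps e0 e1 n _]; first by rewrite invr_gt0.
  by rewrite num_riemann_densitiesE; exact: card_mon_index_ceil.
- by rewrite num_riemann_densitiesE card_mon_index_lt6.
- rewrite !num_riemann_densitiesE; have := card_mon_index6 (n - 6).
  by rewrite subnK // => ->; lia.
Qed.
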